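(* Fix an integer $i\geq 6$ and the data used to construct the groups $T_{\mathcal{P}}$ (as described in the context). Let $\mathcal{P}$ be a group presentation. If the presentation $\mathcal{P}$ has a finite generating set and the group $\pi_1(\mathcal{P})$ is residually finite then the group $T_{\mathcal{P}}$ is residually finite.
   Context: For a presentation $\mathcal{P}=\langle\mathbf{x};\mathbf{r}\rangle$ with $|\mathbf{x}|\leq|\mathbb{N}|$, $\pi_1(\mathcal{P})=F(\mathbf{x})/\langle\langle\mathbf{r}\rangle\rangle$, where $\langle\langle\mathbf{r}\rangle\rangle$ is the normal closure of $\mathbf{r}$ in $F(\mathbf{x})$. For a group $H$, a proper subgroup $K\lneq H$ and $\phi\in\operatorname{Aut}(H)$, put $H\ast_{(K,\phi)}=\langle H,t;\ tkt^{-1}=\phi(k),\ k\in K\rangle$. A subgroup $M\leq H$ is malcharacteristic in $H$ if for all $\delta\in\operatorname{Aut}(H)$: $\delta(M)\cap M\neq 1$ implies $\delta\in\operatorname{Inn}(M):=\{\gamma_h: h\in M\}$, where $\gamma_h(g)=h^{-1}gh$ for $g\in H$. Construction of $T_{\mathcal{P}}$. Let $T_i=\langle a,b;\ a^i,b^i,(ab)^i\rangle$ and let $\phi\in\operatorname{Aut}(T_i)$ be the automorphism $a\mapsto b$, $b\mapsto b^{-1}a^{-1}$. For each $n\in\mathbb{N}\cup\{\infty\}$ (where $\infty=|\mathbb{N}|$) fix a malcharacteristic subgroup $M_n$ of $T_i$ which is free of rank $n$ (such subgroups exist). Given $\mathcal{P}=\langle\mathbf{x};\mathbf{r}\rangle$,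 put $\widehat{\mathbf{x}}=\mathbf{x}\sqcup\{p,q\}$ and $\widehat{\mathbf{r}}=\mathbf{r}\sqcup\{p,q\}$, where $p,q$ are new letters, and identify $F(\widehat{\mathbf{x}})$ with $M_{|\widehat{\mathbf{x}}|}$ via an isomorphism fixed once and for all for each $\mathbf{x}$. Let $K_{\mathcal{P}}\leq M_{|\widehat{\mathbf{x}}|}$ be the subgroup corresponding to the normal closure of $\widehat{\mathbf{r}}$ in $F(\widehat{\mathbf{x}})$. Then $T_{\mathcal{P}}:=T_i\ast_{(K_{\mathcal{P}},\phi)}$. *)

(* Defs.v *)
From HB Require Import structures.
From mathcomp Require Import all_boot fingroup.
From mathcomp Require Import generic_quotient.
From mathcomp Require Import boolp classical_sets functions cardinality.

Set Implicit Arguments.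
Unset Strict Implicit.
Unset Printing Implicit Defensive.

Local Open Scope group_scope.
Local Open Scope quotient_scope.
Local Open Scope classical_set_scope.
Local Open Scope card_scope.

(* The letter [(x, true)] stands for x and [(x, false)] for its inverse.
   [{classic X}] is X itself, seen as a choiceType. *)
Definition word (X : Type) : choiceType := seq ({classic X} * bool).

Inductive free_eqv (X : Type) : word X -> word X -> Prop :=
| free_cancel (u v : word X) (x : X) (e : bool) :
    free_eqv (u ++ [:: (x, e); (x, ~~ e)] ++ v) (u ++ v)
| free_refl u : free_eqv u u
| free_sym u v : free_eqv u v -> free_eqv v u
| free_trans u v w : free_eqv u v -> free_eqv v w -> free_eqv u w.

Definition free_eqvb (X : Type) : rel (word X) := fun u v => `[< free_eqv u v >].

Lemma free_eqvb_refl X : reflexive (@free_eqvb X).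
Proof. by move=> u; apply/asboolP; exact: free_refl. Qed.

Lemma free_eqvb_sym X : symmetric (@free_eqvb X).
Proof. by move=> u v; apply/asboolP/asboolP; exact: free_sym. Qed.

Lemma free_eqvb_trans X : transitive (@free_eqvb X).
Proof.
by move=> v u w /asboolP uv /asboolP vw; apply/asboolP; exact: free_trans vw.
Qed.

Canonical free_equiv X := EquivRel (@free_eqvb X)
  (@free_eqvb_refl X) (@free_eqvb_sym X) (@free_eqvb_trans X).

Definition free_group (X : Type) : Type := {eq_quot @free_eqvb X}.
HB.instance Definition _ X := Choice.on (free_group X).
HB.instance Definition _ X := EqQuotient.on (free_group X).

Section FreeGroup.
Variable X : Type.
Implicit Types u v w : word X.
Local Notation cls := \pi_(free_group X).

Lemma free_piP u v : cls u = cls v <-> free_eqv u v.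
Proof. by split=> [/eqmodP/asboolP|uv]; last exact/eqmodP/asboolP. Qed.

Lemma free_eqv_catl w u v : free_eqv u v -> free_eqv (w ++ u) (w ++ v).
Proof.
elim=> {u v} [u v x e|u|u v _|u v v' _ uv _ vv'].
- by rewrite !(catA w); exact: free_cancel.
- exact: free_refl.
- exact: free_sym.
- exact: free_trans vv'.
Qed.

Lemma free_eqv_catr w u v : free_eqv u v -> free_eqv (u ++ w) (v ++ w).
Proof.
elim=> {u v} [u v x e|u|u v _|u v v' _ uv _ vv'].
- by rewrite -!catA; exact: free_cancel.
- exact: free_refl.
- exact: free_sym.
- exact: free_trans vv'.
Qed.

Definition word_inv u : word X := rev [seq (l.1, ~~ l.2) | l <- u].

Lemma word_inv_eqv u v : free_eqv u v -> free_eqv (word_inv u) (word_inv v).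
Proof.
elim=> {u v} [u v x e|u|u v _|u v v' _ uv _ vv'].
- rewrite /word_inv !map_cat !rev_cat -catA.
  by have := free_cancel (word_inv v) (word_inv u) x e; rewrite -{1}[e]negbK.
- exact: free_refl.
- exact: free_sym.
- exact: free_trans vv'.
Qed.

Lemma word_inv_cat u : free_eqv (word_inv u ++ u) [::].
Proof.
elim: u => [|[x e] u IHu]; first exact: free_refl.
rewrite /word_inv /= rev_cons cat_rcons.
apply: free_trans IHu; rewrite -[_ :: _ :: u]/([:: (x, ~~ e); (x, e)] ++ u).
by have := free_cancel (word_inv u) u x (~~ e); rewrite negbK.
Qed.

Definition free_one : free_group X := cls [::].
Definition free_mul (g h : free_group X) : free_group X :=
  cls (repr g ++ repr h).
Definition free_inv (g : free_group X) : free_group X :=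
  cls (word_inv (repr g)).

Lemma free_repr u : free_eqv (repr (cls u)) u.
Proof. by apply/free_piP; rewrite reprK. Qed.

Lemma free_mul_pi u v :
  free_mul (cls u) (cls v) = cls (u ++ v).
Proof.
apply/free_piP; apply: (@free_trans _ _ (u ++ repr (cls v))).
  exact/free_eqv_catr/free_repr.
exact/free_eqv_catl/free_repr.
Qed.

Lemma free_inv_pi u : free_inv (cls u) = cls (word_inv u).
Proof. exact/free_piP/word_inv_eqv/free_repr. Qed.

Lemma free_ind (Q : free_group X -> Prop) : (forall u, Q (cls u)) -> forall g, Q g.
Proof. by move=> Qu g; rewrite -(reprK g). Qed.

Lemma free_mulA : associative free_mul.
Proof.
elim/free_ind=> u; elim/free_ind=> v; elim/free_ind=> w.
by rewrite !free_mul_pi catA.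
Qed.

Lemma free_mul1 : left_id free_one free_mul.
Proof. by elim/free_ind=> u; rewrite free_mul_pi. Qed.

Lemma free_mulg1 : right_id free_one free_mul.
Proof. by elim/free_ind=> u; rewrite free_mul_pi cats0. Qed.

Lemma free_mulV : left_inverse free_one free_inv free_mul.
Proof.
elim/free_ind=> u; rewrite free_inv_pi free_mul_pi.
exact/free_piP/word_inv_cat.
Qed.

Lemma free_mulgV : right_inverse free_one free_inv free_mul.
Proof.
have invK g : free_inv (free_inv g) = g.
  rewrite -[RHS]free_mul1 -(free_mulV (free_inv g)) -free_mulA.
  by rewrite free_mulV free_mulg1.
by move=> g; rewrite -{1}(invK g) free_mulV.
Qed.

End FreeGroup.

HB.instance Definition _ X := isGroup.Build (free_group X)
  (@free_mulA X) (@free_mul1 X) (@free_mulg1 X) (@free_mulV X) (@free_mulgV X).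

Definition gen (X : Type) (x : X) : free_group X := \pi_(free_group X) [:: (x, true)].

Definition word_eval (X : Type) (G : groupType) (f : X -> G) (u : word X) : G :=
  \prod_(l <- u) (if l.2 then f l.1 else (f l.1)^-1).

(* The morphism extending f : X -> G, by the universal property. *)
Definition free_lift (X : Type) (G : groupType) (f : X -> G) (g : free_group X) : G :=
  word_eval f (repr g).

Section FreeLift.
Variables (X : Type) (G : groupType) (f : X -> G).

Lemma word_eval_eqv u v : free_eqv u v -> word_eval f u = word_eval f v.
Proof.
elim=> {u v} [u v x e|//|u v _ ->//|u v w _ -> _ ->//].
rewrite /word_eval !big_cat !big_cons big_nil /= mulg1; congr (_ * _).
by case: e; rewrite /= ?mulgV ?mulVg mul1g.
Qed.

Lemma free_lift_pi u : free_lift f (\pi_(free_group X) u) = word_eval f u.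
Proof. exact/word_eval_eqv/free_repr. Qed.

Lemma free_lift_morph : {morph free_lift f : g h / g * h}.
Proof.
elim/free_ind=> u; elim/free_ind=> v; rewrite [_ * _]free_mul_pi.
by rewrite !free_lift_pi /word_eval big_cat.
Qed.

HB.instance Definition _ := isMultiplicative.Build _ _ (free_lift f) free_lift_morph.

Lemma free_lift_gen x : free_lift f (gen x) = f x.
Proof. by rewrite free_lift_pi /word_eval big_seq1. Qed.

End FreeLift.

Definition normal_subgroup (G : groupType) (N : set G) : Prop :=
  group_closed (mem N) /\ forall x y, N x -> N (x ^ y).

Definition normal_closure (G : groupType) (R : set G) : set G :=
  smallest (@normal_subgroup G) R.

Section NormalClosureQuotient.
Variables (G : groupType) (R : set G).
Let N := normal_closure R.

Lemma normal_closureP : normal_subgroup N.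
Proof.
split; first split.
- by rewrite inE => A /= [[[/set_mem ? _] _] _].
- move=> x y /set_mem Nx /set_mem Ny; rewrite inE => A /= AP.
  have [[[_ +] _] _] := AP; move=> /(_ x y).
  by rewrite !inE; apply; [exact: Nx|exact: Ny].
- by move=> x y Nx A /= AP; have [[_ +] _] := AP; apply; exact: Nx.
Qed.

Lemma normal_closure_sub : R `<=` N.
Proof. exact: sub_smallest. Qed.

Definition ncl_eqvb : rel G := fun x y => x / y \in N.

Let N1 : 1 \in N. Proof. by case: normal_closureP => -[]. Qed.
Let NF x y : x \in N -> y \in N -> x / y \in N.
Proof. by case: normal_closureP => -[_ +] _; apply. Qed.
Let NV x : x \in N -> x^-1 \in N.
Proof. by move=> /(NF N1); rewrite div1g. Qed.
Let NM x y : x \in N -> y \in N -> x * y \in N.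
Proof. by move=> Nx /NV /(NF Nx); rewrite invgK. Qed.
Let NJ x y : x \in N -> x ^ y \in N.
Proof. by case: normal_closureP => _ +; rewrite !inE; apply. Qed.

Lemma ncl_eqvb_refl : reflexive ncl_eqvb.
Proof. by move=> x; rewrite /ncl_eqvb mulgV. Qed.

Lemma ncl_eqvb_sym : symmetric ncl_eqvb.
Proof. by move=> x y; apply/idP/idP => /NV; rewrite invgF. Qed.

Lemma ncl_eqvb_trans : transitive ncl_eqvb.
Proof. by move=> y x z Nxy /(NM Nxy); rewrite mulgA mulgVK. Qed.

Canonical ncl_equiv := EquivRel ncl_eqvb ncl_eqvb_refl ncl_eqvb_sym ncl_eqvb_trans.

(* G / <<R>> *)
Definition ncl_quot : Type := {eq_quot ncl_eqvb}.
HB.instance Definition _ := Choice.on ncl_quot.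
HB.instance Definition _ := EqQuotient.on ncl_quot.

Definition ncl_proj (x : G) : ncl_quot := \pi_ncl_quot x.

Lemma ncl_projP x y : ncl_proj x = ncl_proj y <-> N (x / y).
Proof.
split=> [/eqmodP|Nxy]; first by rewrite /= /ncl_eqvb inE.
by apply/eqmodP; rewrite /= /ncl_eqvb inE.
Qed.

Definition ncl_one : ncl_quot := ncl_proj 1.
Definition ncl_mul (a b : ncl_quot) : ncl_quot := ncl_proj (repr a * repr b).
Definition ncl_inv (a : ncl_quot) : ncl_quot := ncl_proj (repr a)^-1.

Let ncl_reprK a : ncl_proj (repr a) = a. Proof. exact: reprK. Qed.

Lemma ncl_ind (Q : ncl_quot -> Prop) :
  (forall x, Q (ncl_proj x)) -> forall a, Q a.
Proof. by move=> Qx a; rewrite -(ncl_reprK a). Qed.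

Let ncl_repr x : repr (ncl_proj x) / x \in N.
Proof. by rewrite inE; apply/ncl_projP; rewrite ncl_reprK. Qed.

Lemma ncl_mul_proj x y : ncl_mul (ncl_proj x) (ncl_proj y) = ncl_proj (x * y).
Proof.
apply/ncl_projP; rewrite -in_setE.
set x' := repr _; set y' := repr _.
have -> : x' * y' / (x * y) = (x' / x) * (y' / y) ^ x^-1.
  by rewrite conjgE invgM invgK !mulgA mulgVK.
exact/NM/NJ/ncl_repr/ncl_repr.
Qed.

Lemma ncl_inv_proj x : ncl_inv (ncl_proj x) = ncl_proj x^-1.
Proof.
apply/ncl_projP; rewrite -in_setE invgK.
set x' := repr _.
have -> : x'^-1 * x = (x' / x)^-1 ^ x.
  by rewrite conjgE invgM invgK !mulgA mulVg mul1g.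
exact/NJ/NV/ncl_repr.
Qed.

Lemma ncl_mulA : associative ncl_mul.
Proof.
elim/ncl_ind=> x; elim/ncl_ind=> y; elim/ncl_ind=> z.
by rewrite !ncl_mul_proj mulgA.
Qed.

Lemma ncl_mul1 : left_id ncl_one ncl_mul.
Proof. by elim/ncl_ind=> x; rewrite ncl_mul_proj mul1g. Qed.

Lemma ncl_mulg1 : right_id ncl_one ncl_mul.
Proof. by elim/ncl_ind=> x; rewrite ncl_mul_proj mulg1. Qed.

Lemma ncl_mulV : left_inverse ncl_one ncl_inv ncl_mul.
Proof. by elim/ncl_ind=> x; rewrite ncl_inv_proj ncl_mul_proj mulVg. Qed.

Lemma ncl_mulgV : right_inverse ncl_one ncl_inv ncl_mul.
Proof. by elim/ncl_ind=> x; rewrite ncl_inv_proj ncl_mul_proj mulgV. Qed.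

HB.instance Definition _ := isGroup.Build ncl_quot
  ncl_mulA ncl_mul1 ncl_mulg1 ncl_mulV ncl_mulgV.

Lemma ncl_proj_morph : {morph ncl_proj : x y / x * y}.
Proof. by move=> x y; rewrite [RHS]ncl_mul_proj. Qed.

HB.instance Definition _ := isMultiplicative.Build _ _ ncl_proj ncl_proj_morph.

End NormalClosureQuotient.

Record presentation := Presentation {
  letters : Type;
  letters_countable : countable [set: letters];
  relators : set (free_group letters)
}.
Arguments relators : clear implicits.

Definition pi1 (P : presentation) : groupType := ncl_quot (relators P).

(* H *_(K, phi), with generating set the elements of H and one more letter t,
   subject to the multiplication table of H and t k t^-1 = phi(k) for k in K. *)
Section HNN.
Variables (H : groupType) (K : set H) (phi : H -> H).

Definition hnn_elt (h : H) : free_group (H + unit) := gen (inl h).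
Definition hnn_stable : free_group (H + unit) := gen (inr tt).

Definition hnn_relators : set (free_group (H + unit)) :=
  [set hnn_elt hk.1 * hnn_elt hk.2 / hnn_elt (hk.1 * hk.2) | hk in [set: H * H]]
  `|` [set hnn_stable * hnn_elt k / hnn_stable / hnn_elt (phi k) | k in K].

Definition hnn : groupType := ncl_quot hnn_relators.

End HNN.

Definition residually_finite (G : groupType) : Prop :=
  forall g : G, g <> 1 ->
    exists (Q : finGroupType) (f : {multiplicative G -> Q}), f g <> 1.

Definition malcharacteristic (H : groupType) (M : set H) : Prop :=
  forall delta : {multiplicative H -> H}, bijective delta ->
    (delta @` M) `&` M <> [set 1] ->
    exists2 h, M h & forall g, delta g = g ^ h.

(* Cardinals n in N u {oo}, oo = |N|, are encoded in [option nat]; oo is [None]. *)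
Definition has_card (X : Type) (n : option nat) : Prop :=
  [set: X] #= (if n is Some k then `I_k else [set: nat]).

Definition free_of_rank (H : groupType) (M : set H) (n : option nat) : Prop :=
  exists2 X : Type, has_card X n &
    exists f : {multiplicative free_group X -> H},
      injective f /\ range f = M.

(* The letters a and b are [true] and [false]. *)
Definition triangle_relators (i : nat) : set (free_group bool) :=
  [set gen true ^+ i; gen false ^+ i; (gen true * gen false) ^+ i].

Definition triangle_presentation (i : nat) : presentation :=
  Presentation (countableP [set: bool]) (triangle_relators i).

Definition triangle_group (i : nat) : groupType := pi1 (triangle_presentation i).

Definition tri_a (i : nat) : triangle_group i := ncl_proj (triangle_relators i) (gen true).
Definition tri_b (i : nat) : triangle_group i := ncl_proj (triangle_relators i) (gen false).

(* x-hat is [X + bool], where the new letters p, q are [inr true], [inr false]. *)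
Record TP_data (i : nat) := TPData {
  aut : {multiplicative triangle_group i -> triangle_group i};
  aut_bij : bijective aut;
  aut_a : aut (tri_a i) = tri_b i;
  aut_b : aut (tri_b i) = (tri_b i)^-1 * (tri_a i)^-1;
  M_ : option nat -> set (triangle_group i);
  Mn_subgroup : forall n, group_closed (mem (M_ n));
  Mn_malcharacteristic : forall n, malcharacteristic (M_ n);
  Mn_free : forall n, free_of_rank (M_ n) n;
  (* the fixed isomorphism F(x-hat) -> M_|x-hat|, for each x; its value is
     irrelevant (and unconstrained) when x is uncountable *)
  ident : forall X : Type, {multiplicative free_group (X + bool) -> triangle_group i};
  ident_inj : forall X n, has_card (X + bool) n -> injective (ident X);
  ident_range : forall X n, has_card (X + bool) n -> range (ident X) = M_ n
}.

Arguments M_ {i} D n : rename.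
Arguments ident {i} D X : rename.

Definition hat_relators (P : presentation) : set (free_group (letters P + bool)) :=
  free_lift (fun x => gen (inl x)) @` relators P
  `|` [set gen (inr true); gen (inr false)].

Arguments hat_relators : clear implicits.

Definition K_P (i : nat) (D : TP_data i) (P : presentation) : set (triangle_group i) :=
  ident D (letters P) @` normal_closure (hat_relators P).

Definition T_P (i : nat) (D : TP_data i) (P : presentation) : groupType :=
  hnn (K_P D P) (aut D).

(* Main.v *)
From HB Require Import structures.
Require Import Defs.
From mathcomp Require Import all_boot fingroup perm zmodp cyclic gproduct zify.
From mathcomp Require Import generic_quotient boolp classical_sets cardinality.

(** Write H for the triangle group, M for its subgroup identified with the free
    group on x-hat, and K for the subgroup of M associated with the
    presentation P.

    The extension T_P is residually finite as soon as H is, and K is closed in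
    the profinite topology of H ([hnn_residually_finite]). Since phi has order 3,
    a finite quotient of H separating finitely many elements from K may be taken
    phi-equivariant. A word in H and the stable letter t without pinches then
    acts on finitely many copies, the levels, of that quotient: on every coset
    the stable letter permutes the levels, and the absence of pinches says
    exactly that one may ask it to climb one level at each letter of the word.
    So the word moves level 0 to the last level and is not trivial there.

    The closedness of K ([K_P_separable]) uses residual finiteness of pi1 P, which
    is M / K, to write K as an intersection of subgroups L of finite index in M.
    These are finitely generated, so it remains to see that finitely generated
    subgroups of H are closed, a theorem of Scott ([triangle_separable]). In terms
    of actions: the restriction of an action of H to finitely many points extends
    to an action on a finite set ([partial_action]).

    An H-set is a surface tiled by black and white triangles, the chambers,
    whose sides have colours 0, 1 and 2: it amounts to three involutions r_c,
    crossing the side of colour c, such that (r_j r_k)^i = 1. Fixed points of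
    the involutions are allowed and are called mirrors; the chambers around a
    vertex then form either a cycle of i.*2 chambers, or a row of i chambers
    between two mirrors, or a quotient of these. A finite piece of a tiling is
    completed to a finite closed one in three steps.

    - The piece is first enlarged inside its surface: filling a vertex cell that
      has more than half of its edges in the piece shortens the perimeter, so
      after finitely many fillings every other cell has at most half of its
      edges in the piece ([small_open_cells]), and the chambers of the piece
      around such a vertex form rows of at most i + 1 chambers ([wedge]).
    - A new chamber is glued on each free side, and each row is completed to a
      cycle of i.*2 chambers, which leaves at least one more chamber to add
      between the two glued ones ([chain_solvable]). The new chambers are all
      distinct, even if two rows lie around the same vertex of the surface.
    - The outer sides of the added chambers are closed up by finite patches
      whose remaining sides are mirrors or are glued to each other
      ([fillable_solvable]). Such a patch exists when the numbers of chambers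
      missing at the two ends of the side form a fillable pair, and for
      i >= 6 these numbers can be kept close to i / 2, where all pairs that are
      needed are fillable ([balanced_fillable]). *)

Set Implicit Arguments.
Unset Strict Implicit.
Unset Printing Implicit Defensive.

(** * Gluing chambers on the free sides of a finite family *)

Definition distinct3 (j k l : 'I_3) := [&& j != k, k != l & j != l].

Lemma distinct3P j k l c : distinct3 j k l -> [\/ c = j, c = k | c = l].
Proof.
case: j k l c => [j hj] [k hk] [l hl] [c hc] /and3P[jk kl jl].
have [->|cj] := eqVneq (Ordinal hc) (Ordinal hj); first by constructor 1.
have [->|ck] := eqVneq (Ordinal hc) (Ordinal hk); first by constructor 2.
constructor 3; apply/val_inj; move: jk kl jl cj ck; rewrite -!val_eqE /=; lia.
Qed.

Lemma distinct3_swap j k l : distinct3 j k l -> distinct3 j l k.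
Proof. by rewrite /distinct3 [l == k]eq_sym => /and3P[-> -> ->]. Qed.

Lemma distinct3_rot j k l : distinct3 j k l -> distinct3 k l j.
Proof. by rewrite /distinct3 [l == j]eq_sym [k == j]eq_sym => /and3P[-> -> ->]. Qed.

Section Chambers.
Variables (A : eqType) (rho : 'I_3 -> A -> A) (level : A -> nat) (i : nat).

(** The coordinate of a chamber at the colour l is its seat in the cell around
    its vertex of type l, the one where its sides of the two other colours meet.
    Chambers are glued by giving them neighbouring seats. *)
Definition chamber := {ffun 'I_3 -> A}.

Definition mkchamber (j k l : 'I_3) (a b c : A) : chamber :=
  [ffun x => if x == j then a else if x == k then b else c].

Lemma mkchamberE j k l a b c : distinct3 j k l ->
  [/\ mkchamber j k l a b c j = a, mkchamber j k l a b c k = b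
    & mkchamber j k l a b c l = c].
Proof.
move=> /and3P[jk kl jl]; rewrite !ffunE !eqxx [k == j]eq_sym (negPf jk).
by rewrite [l == j]eq_sym [l == k]eq_sym (negPf jl) (negPf kl).
Qed.

(** The vertex of type c is opposite to the side c, so crossing that side moves
    the seats of the two other types only. *)
Definition adjacent (c : 'I_3) (z z' : chamber) :=
  forall l, l != c -> rho c (z l) = z' l.

Definition resolved (Z : seq chamber) (z : chamber) (c : 'I_3) :=
  exists2 z', z' \in Z & adjacent c z z'.

Lemma adjacentI j k l (z z' : chamber) : distinct3 j k l ->
  rho j (z k) = z' k -> rho j (z l) = z' l -> adjacent j z z'.
Proof.
by move=> d zk zl m mj; have [E|->|->] := distinct3P m d; first rewrite E eqxx in mj.
Qed.

Definition coord_inj (Z : seq chamber) :=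
  forall z z' c, z \in Z -> z' \in Z -> z c = z' c -> z = z'.

(** R contains the seats set aside for chambers still to be added. Levels tell
    which seats are fresh: those occupied or set aside are below B. *)
Definition valid (Z : seq chamber) (B : nat) (R : 'I_3 -> A -> Prop) :=
  [/\ coord_inj Z,
      forall z c, z \in Z -> level (z c) < B /\ ~ R c (z c)
    & forall c a, R c a -> level a < B].

(** N closes all its own sides and those in F, on seats that were set aside or
    are fresh. *)
Definition completes (Z : seq chamber) (B : nat) (R : 'I_3 -> A -> Prop)
    (F : chamber -> 'I_3 -> Prop) :=
  exists N B', [/\ B <= B', coord_inj (N ++ Z),
    forall n c, n \in N -> [/\ resolved (N ++ Z) n c,
      R c (n c) \/ B <= level (n c) & level (n c) < B']
    & forall z c, F z c -> resolved (N ++ Z) z c].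

Definition solvable (Z0 : chamber -> Prop) (R : 'I_3 -> A -> Prop)
    (F : chamber -> 'I_3 -> Prop) :=
  forall Z B, (forall z, Z0 z -> z \in Z) -> valid Z B R -> completes Z B R F.

Lemma resolved_sub Z Z' z c : {subset Z <= Z'} -> resolved Z z c -> resolved Z' z c.
Proof. by move=> ZZ' [z' z'Z E]; exists z' => //; exact: ZZ'. Qed.

(** The first task does not touch the seats set aside for the second one, which
    can therefore be carried out next. *)
Lemma solvable_cat Z0 R1 R2 F1 F2 :
  (forall c a, R1 c a -> ~ R2 c a) ->
  solvable Z0 R1 F1 -> solvable Z0 R2 F2 ->
  solvable Z0 (fun c a => R1 c a \/ R2 c a) (fun z c => F1 z c \/ F2 z c).
Proof.
move=> R12 S1 S2 Z B Z0Z [injZ levZ levR].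
have [|N1 [B1 [BB1 inj1 res1 F1P]]] := S1 Z B Z0Z.
  split=> // [z c zZ|c a ?]; last by apply: (levR c); left.
  by have [? nR] := levZ z c zZ; split=> // ?; apply: nR; left.
have [||N2 [B2 [B12 inj2 res2 F2P]]] := S2 (N1 ++ Z) B1.
- by move=> z /Z0Z zZ; rewrite mem_cat zZ orbT.
- split=> // [z c|c a ?]; last first.
    by apply: leq_trans BB1; apply: (levR c); right.
  rewrite mem_cat => /orP[/(res1 _ c)[_ + lt]|/(levZ _ c)[lt nR]].
    case=> [/R12//|Ble]; split=> // R2z; have := levR c _ (or_intror R2z).
    by rewrite ltnNge Ble.
  by split; [exact: leq_trans BB1|move=> ?; apply: nR; right].
- exists (N2 ++ N1), B2; rewrite -catA; split=> //.
  + exact: leq_trans B12.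
  + move=> n c; rewrite mem_cat => /orP[/(res2 _ c)[? + ?]|/(res1 _ c)[r + lt]].
      by case=> [?|le]; split=> //; [left; right|right; exact: leq_trans le].
    have r' : resolved (N2 ++ N1 ++ Z) n c.
      by apply: resolved_sub r => x xN; rewrite [x \in N2 ++ _]mem_cat xN orbT.
    move=> D; split=> //; last exact: leq_trans B12.
    by case: D => [?|?]; [left; left|right].
  + move=> z c [/F1P|/F2P//].
    by apply: resolved_sub => x; rewrite [x \in N2 ++ _]mem_cat => ->; rewrite orbT.
Qed.

(** The basic step: glue one chamber t and delegate the sides that it leaves
    open to a task already known to be solvable. *)
Lemma completes_add Z B B1 R F R' F' Z0 t :
  (forall z, Z0 z -> z \in t :: Z) ->
  valid Z B R -> B <= B1 ->
  (forall c, (R c (t c) \/ B <= level (t c)) /\ level (t c) < B1) ->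
  (forall c a, R' c a -> (R c a \/ B <= level a < B1) /\ a <> t c) ->
  (forall c, resolved (t :: Z) t c \/ F' t c) ->
  (forall z c, F z c -> resolved (t :: Z) z c \/ F' z c) ->
  solvable Z0 R' F' -> completes Z B R F.
Proof.
move=> Z0Z [injZ levZ levR] BB1 tP R'P resT FP S'.
have tZ z c : z \in Z -> t c <> z c.
  move=> /(levZ _ c)[lt nR] E; have [+ _] := tP c.
  by rewrite E => -[//|]; rewrite leqNgt lt.
have [|N [B2 [B12 injN resN FN]]] := S' (t :: Z) B1 Z0Z.
  split.
  - move=> z z' c; rewrite !inE => /orP[/eqP->|zZ] /orP[/eqP->|z'Z] // E.
    + by case: (tZ z' c z'Z).
    + by case: (tZ z c zZ).
    + exact: injZ E.
  - move=> z c; rewrite inE => /orP[/eqP->|zZ].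
      by have [_ ?] := tP c; split=> // /R'P[].
    have [lt nR] := levZ z c zZ; split; first exact: leq_trans BB1.
    by move=> /R'P[[//|]]; rewrite leqNgt lt.
  - move=> c a /R'P[[/levR lt|/andP[]//] _].
    exact: leq_trans BB1.
exists (N ++ [:: t]), B2; rewrite -catA /=; split=> //.
- exact: leq_trans B12.
- move=> n c; rewrite mem_cat inE => /orP[/(resN _ c)[r D lt]|/eqP->].
    split=> //; case: D => [/R'P[[?|/andP[? _]] _]|?]; [by left|by right|right].
    exact: leq_trans BB1 _.
  have [D lt] := tP c; split=> //; last exact: leq_trans B12.
  by case: (resT c) => [|/FN//]; apply: resolved_sub => x; rewrite mem_cat orbC => ->.
- move=> z c /FP[|/FN//].
  by apply: resolved_sub => x; rewrite mem_cat orbC => ->.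
Qed.

Lemma completes_nil Z B R (F : chamber -> 'I_3 -> Prop) : coord_inj Z ->
  (forall z c, F z c -> resolved Z z c) -> completes Z B R F.
Proof. by move=> injZ FZ; exists [::], B. Qed.

(** Crossing sides j, k, j, ... from the seat a leads through s to a mirror. *)
Fixpoint mirror_walk (r : 'I_3 -> A -> A) (j k : 'I_3) (a : A) (s : seq A) : Prop :=
  if s is b :: s' then r j a = b /\ mirror_walk r k j b s' else r j a = a.

(** The same with a seat a' instead of the mirror, reached by crossing a side
    of colour c. *)
Fixpoint chain_walk (r : 'I_3 -> A -> A) (j k : 'I_3) (a : A) (s : seq A) (a' : A)
    (c : 'I_3) : Prop :=
  if s is b :: s' then r j a = b /\ chain_walk r k j b s' a' c else r j a = a' /\ c = j.

(** (p, q) is fillable when a free side can be closed up if p more chambers are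
    wanted around one of its ends and q around the other, the last ones having
    mirrors. Either nothing is wanted and the side is a mirror; or one chamber
    with two mirrors is glued; or two chambers, glued together along two
    sides, are put on the side; or one chamber is put on it, whose
    vertex opposite to the side gets a row of i chambers made of q chambers on one
    side, itself, and p' on the other. *)
Inductive fillable : nat -> nat -> Prop :=
| fillable0 : fillable 0 0
| fillable1 : fillable 1 1
| fillable_bigon p q : fillable p q -> fillable p.+2 q.+2
| fillable_row p q p' q' : fillable p q -> fillable p' q' -> q + p' + 1 = i ->
    fillable p.+1 q'.+1.

Hypothesis rhoK : forall c, involutive (rho c).
Hypothesis fresh_row : forall j k l n m B, distinct3 j k l -> n + m + 1 = i ->
  exists x w w', [/\ mirror_walk rho k l x w, mirror_walk rho l k x w',
    size w = n, size w' = m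
    & uniq (x :: w ++ w') /\ all (fun a => level a == B) (x :: w ++ w')].
Hypothesis fresh_one : forall j k l B, distinct3 j k l ->
  exists x, [/\ rho k x = x, rho l x = x & level x = B].
Hypothesis fresh_bigon : forall j k l B, distinct3 j k l ->
  exists x y, [/\ rho k x = y, rho l x = y, x != y,
                  level x = B & level y = B].

Definition reserve2 (l k : 'I_3) (s s' : seq A) (c : 'I_3) (a : A) : Prop :=
  (c = l /\ a \in s) \/ (c = k /\ a \in s').

Definition single_side (z : chamber) (c : 'I_3) (z' : chamber) (c' : 'I_3) : Prop :=
  z' = z /\ c' = c.

Lemma valid_mem Z B R c a : valid Z B R -> R c a -> level a < B.
Proof. by case=> _ _; apply. Qed.

Lemma adjacent_sym c z z' : adjacent c z z' -> adjacent c z' z.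
Proof. by move=> zz' l lc; rewrite -(zz' l lc) rhoK. Qed.

(** By induction: gluing the chambers described by a constructor leaves sides
    with the smaller pairs it mentions. *)
Lemma fillable_solvable p q : fillable p q ->
  forall j k l (z : chamber) s s', distinct3 j k l ->
  size s = p -> size s' = q -> uniq s -> uniq s' ->
  mirror_walk rho j k (z l) s -> mirror_walk rho j l (z k) s' ->
  solvable (eq z) (reserve2 l k s s') (single_side z j).
Proof.
elim=> {p q} [||p q _ IH|p q p' q' _ IH1 _ IH2 qp'].
- move=> j k l z [|//] [|//] d _ _ _ _ /= zl zk Z B zZ [injZ _ _].
  apply: completes_nil => // z' c [-> ->]; exists z; first exact: zZ.
  exact: adjacentI d _ _.
- move=> j k l z [//|a [|//]] [//|b [|//]] d _ _ _ _ /= [zl al] [zk bk] Z B zZ V.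
  have [x [xk xl xB]] := fresh_one B d.
  pose t := mkchamber j k l x b a.
  have [tj tk tl] : [/\ t j = x, t k = b & t l = a] by exact: mkchamberE.
  have zt : adjacent j z t by apply: adjacentI d _ _; rewrite ?tk ?tl.
  have tt c : c != j -> adjacent c t t.
    move=> cj; have [E|->|->] := distinct3P c d; first by rewrite E eqxx in cj.
      by apply: adjacentI (distinct3_rot d) _ _; rewrite ?tj ?tl.
    by apply: adjacentI (distinct3_rot (distinct3_rot d)) _ _; rewrite ?tj ?tk.
  have Rb : reserve2 l k [:: a] [:: b] k b by right; rewrite mem_head.
  have Ra : reserve2 l k [:: a] [:: b] l a by left; rewrite mem_head.
  apply: (completes_add (B1 := B.+1) (Z0 := fun=> False) (R' := fun _ _ => False)
           (F' := fun _ _ => False) (t := t) _ V) => //.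
  + move=> c; have [->|->|->] := distinct3P c d; rewrite ?tj ?tk ?tl.
    * by rewrite xB; split; [right|].
    * by split; [left|exact: leqW (valid_mem V Rb)].
    * by split; [left|exact: leqW (valid_mem V Ra)].
  + move=> c; left; have [->|cj] := eqVneq c j.
      by exists z; [rewrite inE zZ ?orbT|exact: adjacent_sym].
    by exists t; [exact: mem_head|exact: tt].
  + by move=> z' c [-> ->]; left; exists t; [exact: mem_head|].
  + by move=> Z' B' _ [injZ' _ _]; exact: completes_nil.
- move=> j k l z [//|a [//|a2 s]] [//|b [//|b2 s']] d /= [sp] [sq].
  rewrite !inE !negb_or => /and3P[/andP[aa2 as_] a2s us].
  move=> /and3P[/andP[bb2 bs] b2s us'] [zl [al ts]] [zk [bk ts']] Z B zZ V.
  have [x [y [xk xl xy xB yB]]] := fresh_bigon B d.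
  pose t1 := mkchamber j k l x b a; pose t2 := mkchamber j k l y b2 a2.
  have [tj tk tl] : [/\ t1 j = x, t1 k = b & t1 l = a] by exact: mkchamberE.
  have [t2j t2k t2l] : [/\ t2 j = y, t2 k = b2 & t2 l = a2] by exact: mkchamberE.
  have zt : adjacent j z t1 by apply: adjacentI d _ _; rewrite ?tk ?tl.
  have tt c : c != j -> adjacent c t1 t2.
    move=> cj; have [E|->|->] := distinct3P c d; first by rewrite E eqxx in cj.
      by apply: adjacentI (distinct3_rot d) _ _; rewrite ?tj ?tl ?t2j ?t2l.
    by apply: adjacentI (distinct3_rot (distinct3_rot d)) _ _;
      rewrite ?tj ?tk ?t2j ?t2k.
  have Ra : reserve2 l k (a :: a2 :: s) (b :: b2 :: s') l a.
    by left; rewrite mem_head.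
  have Rb : reserve2 l k (a :: a2 :: s) (b :: b2 :: s') k b.
    by right; rewrite mem_head.
  have /and3P[jk kl jl] := d.
  pose R1 c a' := reserve2 l k (a2 :: s) (b2 :: s') c a' \/ (c = j /\ a' = y).
  pose F1 z c := single_side t1 k z c \/ single_side t1 l z c.
  have S1 : solvable (eq t1) R1 F1.
    move=> Z1 B1 t1Z V1.
    have R1a : R1 l a2 by left; left; rewrite mem_head.
    have R1b : R1 k b2 by left; right; rewrite mem_head.
    have R1y : R1 j y by right.
    have S2 : solvable (eq t2) (reserve2 l k s s') (single_side t2 j).
      by apply: IH; rewrite ?t2l ?t2k.
    apply: (completes_add (t := t2) _ V1 (leqnn _) _ _ _ _ S2) => //.
    + by move=> _ <-; rewrite mem_head.
    + move=> c; have [->|->|->] := distinct3P c d; rewrite ?t2j ?t2k ?t2l.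
      * by split; [left|exact: valid_mem V1 R1y].
      * by split; [left|exact: valid_mem V1 R1b].
      * by split; [left|exact: valid_mem V1 R1a].
    + move=> c a' [[-> a's]|[-> a's]]; (split; first left).
      * by left; left; rewrite inE a's orbT.
      * by rewrite t2l => E; rewrite -E a's in a2s.
      * by left; right; rewrite inE a's orbT.
      * by rewrite t2k => E; rewrite -E a's in b2s.
    + move=> c; have [->|cj] := eqVneq c j; first by right.
      left; exists t1; first by rewrite inE t1Z ?orbT.
      exact/adjacent_sym/tt.
    + by move=> z' c [] [-> ->]; left; exists t2; rewrite ?mem_head //;
        apply: tt; rewrite eq_sym.
  apply: (completes_add (t := t1) (B1 := B.+1) _ V _ _ _ _ _ S1) => //.
  + by move=> _ <-; rewrite mem_head.
  + move=> c; have [->|->|->] := distinct3P c d; rewrite ?tj ?tk ?tl.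
    * by rewrite xB; split; [right|].
    * by split; [left|exact: leqW (valid_mem V Rb)].
    * by split; [left|exact: leqW (valid_mem V Ra)].
  + move=> c a' [[[-> a's]|[-> a's]]|[-> ->]].
    * split; first by left; left; rewrite inE a's orbT.
      rewrite tl => E; move: a's; rewrite E inE (negPf aa2) /= => a's.
      by rewrite a's in as_.
    * split; first by left; right; rewrite inE a's orbT.
      rewrite tk => E; move: a's; rewrite E inE (negPf bb2) /= => a's.
      by rewrite a's in bs.
    * by split; [right; rewrite yB leqnn /=|rewrite tj => E; rewrite E eqxx in xy].
  + move=> c; have [->|->|->] := distinct3P c d; [left|by right; left|by right; right].
    by exists z; [rewrite inE zZ ?orbT|exact: adjacent_sym].
  + by move=> z' c [-> ->]; left; exists t1; rewrite ?mem_head.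
- move=> j k l z [//|a s] [//|b s'] d /= [sp] [sq'] /andP[as_ us] /andP[bs us'].
  move=> [zl ts] [zk ts'] Z B zZ V.
  have [x [w [w' [tw tw' wq wp' [/= /andP[]]]]]] := fresh_row B d qp'.
  rewrite mem_cat negb_or cat_uniq => /andP[xw xw'] /and3P[uw ww' uw'].
  move=> /andP[/eqP xB]; rewrite all_cat => /andP[/allP wB /allP w'B].
  pose t := mkchamber j k l x b a.
  have [tj tk tl] : [/\ t j = x, t k = b & t l = a] by exact: mkchamberE.
  have zt : adjacent j z t by apply: adjacentI d _ _; rewrite ?tk ?tl.
  have /and3P[jk kl jl] := d.
  have S1 : solvable (eq t) (reserve2 l j s w) (single_side t k).
    apply: IH1; rewrite ?tl ?tj //.
    by rewrite /distinct3 [k == j]eq_sym jk kl jl.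
  have S2 : solvable (eq t) (reserve2 j k w' s') (single_side t l).
    apply: IH2; rewrite ?tk ?tj //.
    by rewrite /distinct3 ![_ == j]eq_sym [l == k]eq_sym jk kl jl.
  have Rb : reserve2 l k (a :: s) (b :: s') k b by right; rewrite mem_head.
  have Ra : reserve2 l k (a :: s) (b :: s') l a by left; rewrite mem_head.
  have S12 := solvable_cat _ S1 S2.
  apply: (completes_add (t := t) (B1 := B.+1) _ V _ _ _ _ _ (S12 _)) => //.
  + by move=> _ <-; rewrite mem_head.
  + move=> c; have [->|->|->] := distinct3P c d; rewrite ?tj ?tk ?tl.
    * by rewrite xB; split; [right|].
    * by split; [left|exact: leqW (valid_mem V Rb)].
    * by split; [left|exact: leqW (valid_mem V Ra)].
  + move=> c e [[[-> es]|[-> ew]]|[[-> ew]|[-> es]]].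
    * split; first by left; left; rewrite inE es orbT.
      by rewrite tl => E; rewrite -E es in as_.
    * split; first by right; rewrite (eqP (wB _ ew)) leqnn /=.
      by rewrite tj => E; rewrite -E ew in xw.
    * split; first by right; rewrite (eqP (w'B _ ew)) leqnn /=.
      by rewrite tj => E; rewrite -E ew in xw'.
    * split; first by left; right; rewrite inE es orbT.
      by rewrite tk => E; rewrite -E es in bs.
  + move=> c; have [->|->|->] := distinct3P c d; [left|by right; left|by right; right].
    by exists z; [rewrite inE zZ ?orbT|exact: adjacent_sym].
  + by move=> z' c [-> ->]; left; exists t; rewrite ?mem_head.
  + move=> c e [[-> _]|[-> ew]] [[E ew']|[E _]].
    * by rewrite E eqxx in jl.
    * by rewrite E eqxx in kl.
    * by case/negP: ww'; apply/hasP; exists e.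
    * by rewrite E eqxx in jk.
Qed.

Lemma solvable_sub (Z0 Z1 : chamber -> Prop) R (F0 F1 : chamber -> 'I_3 -> Prop) :
  (forall z, Z0 z -> Z1 z) -> (forall z c, F1 z c -> F0 z c) ->
  solvable Z0 R F0 -> solvable Z1 R F1.
Proof.
move=> Z01 F10 S Z B Z1Z V; have [|N [B' [? ? ? FN]]] := S Z B _ V.
  by move=> z /Z01/Z1Z.
by exists N, B'; split=> // z c /F10/FN.
Qed.

(** Lengths of mirrored rows along which a chain of chambers can be continued;
    the boolean changes from one chamber of the chain to the next. *)
Variable balanced : bool -> nat -> Prop.
Hypothesis balanced_gt0 : forall e n, balanced e n -> 0 < n.
Hypothesis balanced_step : forall e n, balanced e n ->
  exists u v, [/\ fillable n.-1 u, v + u + 1 = i & balanced (~~ e) v].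
Hypothesis balanced_fillable : forall e n m, balanced e n -> balanced e m ->
  fillable n.-1 m.-1.

Definition reserve3 (l k d : 'I_3) (s ys ys' : seq A) (c : 'I_3) (a : A) : Prop :=
  [\/ c = l /\ a \in s, c = k /\ a \in ys | c = d /\ a \in ys'].

(** The row s of empty seats between t and t' is filled starting from t. The outer
    side of each new chamber has, at one end, what is left of the row of the
    previous chamber and, at the other, one part of a new row of i seats; this new
    row is cut so that the pair is fillable while its other part is balanced
    again. The last chamber has no choice: its outer side lies between
    two balanced rows. *)
Lemma chain_solvable s : forall j k l (t t' : chamber) c' d' ys ys' e,
  distinct3 j k l -> distinct3 c' d' l -> s != [::] -> uniq s ->
  chain_walk rho j k (t l) s (t' l) c' ->
  mirror_walk rho j l (t k) ys -> mirror_walk rho c' l (t' d') ys' ->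
  uniq ys -> uniq ys' -> (k = d' -> forall a, a \in ys -> a \notin ys') ->
  balanced e (size ys) -> balanced (e (+) ~~ odd (size s)) (size ys') ->
  solvable (fun z => z = t \/ z = t') (reserve3 l k d' s ys ys')
    (fun z c => single_side t j z c \/ single_side t' c' z c).
Proof.
elim: s => [//|a [|a2 s] IH] j k l t t' c' d' ys ys' e dj dc _.
- move=> _ [tl [al cE]]; subst c'.
  have [E|dk|E] := distinct3P d' dj; first last.
  - by move: dc; rewrite E /distinct3 eqxx andbF.
  - by move: dc; rewrite dk /distinct3 eqxx.
  subst d'.
  case: ys ys' => [|y yr] [|y' yr'] ty ty' uy uy' _ /= be be'.
  - by have := balanced_gt0 be.
  - by have := balanced_gt0 be.
  - by have := balanced_gt0 be'.
  move: uy uy' ty ty' => /= /andP[yyr uyr] /andP[yyr' uyr'] [tk ty] [t'j ty'].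
  move=> Z B Z0Z V.
  pose z := mkchamber j k l y' y a.
  have [zj zk zl] : [/\ z j = y', z k = y & z l = a] by exact: mkchamberE.
  have tz : adjacent j t z by apply: adjacentI dj _ _; rewrite ?zk ?zl.
  have t'z : adjacent k t' z.
    by apply: adjacentI (distinct3_rot dj) _ _; rewrite ?zj ?zl // -al rhoK.
  have Rj : reserve3 l k j [:: a] (y :: yr) (y' :: yr') j y'.
    by constructor 3; rewrite mem_head.
  have Rk : reserve3 l k j [:: a] (y :: yr) (y' :: yr') k y.
    by constructor 2; rewrite mem_head.
  have Rl : reserve3 l k j [:: a] (y :: yr) (y' :: yr') l a.
    by constructor 1; rewrite mem_head.
  have S : solvable (eq z) (reserve2 k j yr yr') (single_side z l).
    rewrite addbF in be'.
    apply: (fillable_solvable (balanced_fillable be be')); rewrite ?zk ?zj //.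
    exact/distinct3_rot/distinct3_rot.
  apply: (completes_add (t := z) _ V (leqnn _) _ _ _ _ S).
  + by move=> _ <-; rewrite mem_head.
  + move=> c; have [->|->|->] := distinct3P c dj; rewrite ?zj ?zk ?zl.
    * by split; [left|exact: valid_mem V Rj].
    * by split; [left|exact: valid_mem V Rk].
    * by split; [left|exact: valid_mem V Rl].
  + move=> c b [[-> bs]|[-> bs]].
    * split; first by left; constructor 2; rewrite inE bs orbT.
      by rewrite zk => E; rewrite -E bs in yyr.
    * split; first by left; constructor 3; rewrite inE bs orbT.
      by rewrite zj => E; rewrite -E bs in yyr'.
  + move=> c; have [->|->|->] := distinct3P c dj; [left|left|by right].
      exists t; first by rewrite inE Z0Z ?orbT //; left.
      exact: adjacent_sym.
    exists t'; first by rewrite inE Z0Z ?orbT //; right.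
    exact: adjacent_sym.
  + by move=> z' c [[-> ->]|[-> ->]]; left; exists z; rewrite ?mem_head.
- move=> /andP[as_ us] [tl tc].
  case: ys => [|y yr] ty ty'; first by move=> _ _ _ /balanced_gt0.
  move: ty => /= [tk ty] /andP[yyr uyr] uy' ydis be be' Z B Z0Z V.
  have [u [v [tu uv bv]]] := balanced_step be.
  have [x [w [w' [tw tw' wv w'u [/= /andP[]]]]]] := fresh_row B dj uv.
  rewrite mem_cat negb_or cat_uniq => /andP[xw xw'] /and3P[uw ww' uw'].
  move=> /andP[/eqP xB]; rewrite all_cat => /andP[/allP wB /allP w'B].
  pose z := mkchamber j k l x y a.
  have [zj zk zl] : [/\ z j = x, z k = y & z l = a] by exact: mkchamberE.
  have tz : adjacent j t z by apply: adjacentI dj _ _; rewrite ?zk ?zl.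
  have /and3P[jk kl jl] := dj.
  have S1 : solvable (fun z' => z' = z \/ z' = t') (reserve2 k j yr w') (single_side z l).
    apply: (@solvable_sub (eq z) _ _ (single_side z l)) => //; first by move=> _ <-; left.
    rewrite -w'u in tu.
    apply: (fillable_solvable tu); rewrite ?zk ?zj //.
    exact/distinct3_rot/distinct3_rot.
  have wlt b : b \in w -> level b = B by move/wB/eqP.
  have y'lt b : b \in ys' -> level b < B.
    move=> by'.
    have Rb : reserve3 l k d' (a :: a2 :: s) (y :: yr) ys' d' b by constructor 3.
    exact: valid_mem V Rb.
  have S2 : solvable (fun z' => z' = z \/ z' = t')
     (reserve3 l j d' (a2 :: s) w ys')
     (fun z' c => single_side z k z' c \/ single_side t' c' z' c).
    apply: IH ty' _ _ _ _ _; rewrite ?zl ?zj //.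
    - by rewrite /distinct3 [k == j]eq_sym jk kl jl.
    - by move=> _ b /wlt bB; apply/negP => /y'lt; rewrite bB ltnn.
    - by rewrite wv; exact: bv.
    - by move: be'; rewrite /= !negbK; case: (e); case: (odd (size s)).
  have Rk : reserve3 l k d' (a :: a2 :: s) (y :: yr) ys' k y.
    by constructor 2; rewrite mem_head.
  have Rl : reserve3 l k d' (a :: a2 :: s) (y :: yr) ys' l a.
    by constructor 1; rewrite mem_head.
  have S12 := solvable_cat _ S1 S2.
  apply: (completes_add (t := z) (B1 := B.+1) _ V _ _ _ _ _ (S12 _)) => //.
  + by move=> _ [->|->]; rewrite ?mem_head // inE Z0Z ?orbT //; right.
  + move=> c; have [->|->|->] := distinct3P c dj; rewrite ?zj ?zk ?zl.
    * by rewrite xB; split; [right|].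
    * by split; [left|exact: leqW (valid_mem V Rk)].
    * by split; [left|exact: leqW (valid_mem V Rl)].
  + move=> c b [[[-> bs]|[-> bs]]|[[-> bs]|[-> bs]|[cd bs]]].
    * split; first by left; constructor 2; rewrite inE bs orbT.
      by rewrite zk => E; rewrite -E bs in yyr.
    * split; first by right; rewrite (eqP (w'B _ bs)) leqnn /=.
      by rewrite zj => E; rewrite -E bs in xw'.
    * split; first by left; constructor 1; rewrite inE bs orbT.
      by rewrite zl => E; rewrite -E bs in as_.
    * split; first by right; rewrite (eqP (wB _ bs)) leqnn /=.
      by rewrite zj => E; rewrite -E bs in xw.
    * split; first by left; constructor 3.
      have [Ec|Ec|Ec] := distinct3P c dj => E; rewrite {}Ec in cd E *.
      - by move: (y'lt _ bs); rewrite E zj xB ltnn.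
      - by move: bs; rewrite E zk; apply/negP/ydis; rewrite ?mem_head.
      - by move: dc; rewrite -cd /distinct3 eqxx andbF.
  + move=> c; have [->|->|->] := distinct3P c dj.
    * left; exists t; first by rewrite inE Z0Z ?orbT //; left.
      exact: adjacent_sym.
    * by right; right; left.
    * by right; left.
  + move=> z' c [[-> ->]|F]; last by right; right; right.
    by left; exists z; rewrite ?mem_head.
  + move=> c b [[-> b1]|[-> b1]] [[E b2]|[E b2]|[E b2]].
    * by rewrite E eqxx in kl.
    * by rewrite E eqxx in jk.
    * by move: b2; apply/negP/ydis; rewrite // inE b1 orbT.
    * by rewrite E eqxx in jl.
    * by case/negP: ww'; apply/hasP; exists b.
    * by move: (y'lt _ b2); rewrite (eqP (w'B _ b1)) ltnn.
Qed.

End Chambers.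

(** * Fillable pairs *)

Section FillableArithmetic.
Variable i : nat.
Hypothesis i_ge6 : 6 <= i.

Lemma fillable_diag n : fillable i n n.
Proof.
have [m] := ubnP n; elim: m n => // m IH [|[|n]] lt; [exact: fillable0|exact: fillable1|].
apply: fillable_bigon; apply: IH; lia.
Qed.

Lemma fillable_sym p q : fillable i p q -> fillable i q p.
Proof.
elim=> {p q} [||p q _|p q p' q' _ t1 _ t2 E]; [exact: fillable0|exact: fillable1| |].
  exact: fillable_bigon.
by apply: (fillable_row t2 t1); lia.
Qed.

(** Two diagonal pairs on one row give (p + 2, i - p - 1), whose second entry is
    just what (p, q) needs to complete a row. *)
Lemma fillable_step31 p q : p.+1 < i -> fillable i p q -> fillable i p.+3 q.+1.
Proof.
move=> lt t; apply: (fillable_row (p := p.+2) (q := i - p.+1) _ t); last lia.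
have -> : i - p.+1 = (i - p.+2).+1 by lia.
by apply: (fillable_row (fillable_diag p.+1) (fillable_diag _)); lia.
Qed.

(** Lengths close to i / 2. For odd i both entries of a fillable pair have the same
    parity, so the parity has to be prescribed as well. *)
Definition balanced (e : bool) (n : nat) : Prop :=
  if odd i then [/\ odd n = e, i./2 <= n.+1 & n <= i./2.+1]
  else n.+1 = i./2 \/ n = i./2.

Lemma balanced_gt0 e n : balanced e n -> 0 < n.
Proof. by rewrite /balanced; case: ifP => [_ []|_ []]; lia. Qed.

Lemma fillable_add2 n : 0 < n -> n < i -> fillable i n.+2 n.
Proof. by case: n => // n _ lt; apply: fillable_step31 (fillable_diag n); lia. Qed.

(** For even i, pairs of odd difference are needed too. Two pairs of difference
    2 with opposite signs, put on one row, give (n + 1, n). For i = 6 one of them would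
    be (2, 0), and (2, 1) is reached from (3, 2), (5, 4) and (1, 5) instead. *)
Lemma fillable_half_even n : ~~ odd i -> n.+2 = i./2 -> fillable i n.+1 n.
Proof.
move=> ei ni; have [i6|i8] : i = 6 \/ 8 <= i by lia.
  have -> : n = 1 by lia.
  have t32 : fillable i 3 2.
    by apply: (fillable_row (fillable_diag 2) (fillable_step31 _ (fillable_diag 0))); lia.
  have t54 : fillable i 5 4 by apply: fillable_step31 (fillable_sym t32); lia.
  have t15 : fillable i 1 5 by apply: (fillable_row (fillable0 i) t54); lia.
  by apply: (fillable_row t15 (fillable0 i)); lia.
have t1 : fillable i n n.+2 by apply/fillable_sym/fillable_add2; lia.
have t2 : fillable i n.+1 n.-1.
  have -> : n.+1 = n.-1.+2 by lia.
  by apply: fillable_add2; lia.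
have := fillable_row t1 t2; rewrite prednK; last lia.
by apply; lia.
Qed.

Lemma balanced_fillable e n m : balanced e n -> balanced e m -> fillable i n.-1 m.-1.
Proof.
rewrite /balanced; case: ifP => [oi [en n1 n2] [em m1 m2]|ei].
  have [->|[E|E]] : n = m \/ n = m.+2 \/ m = n.+2 by lia.
  - exact: fillable_diag.
  - have -> : n.-1 = m.-1.+2 by lia.
    by apply: fillable_add2; lia.
  - have -> : m.-1 = n.-1.+2 by lia.
    by apply/fillable_sym/fillable_add2; lia.
move=> [En|En] [Em|Em].
- have -> : n = m by lia.
  by exact: fillable_diag.
- have -> : m.-1 = n.-1.+1 by lia.
  by apply/fillable_sym/fillable_half_even; lia.
- have -> : n.-1 = m.-1.+1 by lia.
  by apply/fillable_half_even; lia.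
- have -> : n = m by lia.
  by exact: fillable_diag.
Qed.

Lemma balanced_step e n : balanced e n ->
  exists u v, [/\ fillable i n.-1 u, v + u + 1 = i & balanced (~~ e) v].
Proof.
move=> bn; have n0 := balanced_gt0 bn; move: bn; rewrite /balanced.
case: ifP => [oi [en n1 n2]|ei].
  have [E|lt] := eqVneq n.+1 i./2.
    exists n.+1, (i - n.+2); split; [|lia|split; lia].
    have -> : n.+1 = n.-1.+2 by lia.
    by apply/fillable_sym/fillable_add2; lia.
  by exists n.-1, (i - n); split; [exact: fillable_diag|lia|split; lia].
case=> E; last by exists n.-1, (i - n); split; [exact: fillable_diag|lia|lia].
exists n, (i - n.+1); split; [|lia|lia].
by rewrite -{2}(prednK n0); apply/fillable_sym/fillable_half_even; lia.
Qed.

Lemma balanced_split e : exists u v, [/\ u + v + 1 = i, balanced e u & balanced e v].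
Proof.
rewrite /balanced; have [oi|ei] := boolP (odd i).
  case: (boolP (odd i./2 == e)) => [/eqP E|/eqP E].
    by exists i./2, i./2; split; [lia|split; lia|split; lia].
  by exists i./2.+1, i./2.-1; split; [lia|split; lia|split; lia].
by exists i./2, i./2.-1; split; lia.
Qed.

End FillableArithmetic.

(** * Shortening the perimeter of a finite piece *)

Section Tiling.
Variables (G : eqType) (r : 'I_3 -> G -> G) (i : nat).
Hypothesis i_gt0 : 0 < i.
Hypothesis rK : forall c, involutive (r c).
Hypothesis r_period : forall j k v, iter i (fun w => r k (r j w)) v = v.

Fixpoint walk (j k : 'I_3) (n : nat) (v : G) : G :=
  if n is n'.+1 then walk k j n' (r j v) else v.

Definition letter (j k : 'I_3) (n : nat) := if odd n then k else j.

Lemma walkS j k n v : walk j k n.+1 v = r (letter j k n) (walk j k n v).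
Proof.
elim: n j k v => [//|n IH] j k v; rewrite -[walk j k n.+2 v]/(walk k j n.+1 (r j v)) IH.
by rewrite /letter /=; case: (odd n).
Qed.

Lemma walk_back j k n v : r (letter j k n) (walk j k n.+1 v) = walk j k n v.
Proof. by rewrite walkS rK. Qed.

Lemma walk_add j k m n v :
  walk j k (m + n) v = walk (letter j k m) (letter k j m) n (walk j k m v).
Proof.
elim: m j k v => [//|m IH] j k v.
by rewrite addSn /= IH /letter /=; case: (odd m).
Qed.

Lemma walk_double j k n v : walk j k n.*2 v = iter n (fun w => r k (r j w)) v.
Proof. by elim: n v => [//|n IH] v; rewrite iterSr /= IH. Qed.

Lemma walk_period j k v : walk j k i.*2 v = v.
Proof. by rewrite walk_double r_period. Qed.

(** The walk around a vertex closes up after i.*2 steps. *)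
Lemma walk_rev j k n v : n <= i.*2 -> walk j k n v = walk k j (i.*2 - n) v.
Proof.
elim: n => [|n IH] le; first by rewrite subn0 walk_period.
rewrite walkS IH; last lia.
have -> : i.*2 - n = (i.*2 - n.+1).+1 by lia.
rewrite walkS.
have -> : letter k j (i.*2 - n.+1) = letter j k n.
  by rewrite /letter oddB // odd_double /=; case: (odd n).
by rewrite rK.
Qed.

Definition orb j k v := [seq walk j k n v | n <- iota 0 i.*2].

Lemma orb_self j k v : v \in orb j k v.
Proof. by apply/mapP; exists 0; rewrite // mem_iota; lia. Qed.

Lemma orbP j k v w :
  reflect (exists2 n, n < i.*2 & w = walk j k n v) (w \in orb j k v).
Proof.
apply: (iffP mapP) => [] [n]; rewrite ?mem_iota => nlt ->; exists n => //.
by rewrite mem_iota.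
Qed.

Lemma walk_orb j k v n : walk j k n v \in orb j k v.
Proof.
elim/ltn_ind: n => n IH; have [lt|ge] := ltnP n i.*2; first by apply/orbP; exists n.
have -> : n = i.*2 + (n - i.*2) by lia.
rewrite walk_add walk_period /letter odd_double; apply: IH; lia.
Qed.

Lemma orb_closed j k v w c : c \in [:: j; k] -> w \in orb j k v -> r c w \in orb j k v.
Proof.
move=> cjk /orbP[n nlt ->].
have [->|cn] := eqVneq c (letter j k n); first by rewrite -walkS walk_orb.
case: n nlt cn => [|n] nlt cn.
  have -> : c = k by move: cn cjk; rewrite /letter !inE /= => /negPf-> /eqP.
  have -> : r k (walk j k 0 v) = walk k j 1 v by [].
  by rewrite walk_rev ?walk_orb //; lia.
have -> : c = letter j k n; last by rewrite walk_back walk_orb.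
move: cn cjk; rewrite /letter /= !inE.
by case: (odd n) => /= /negPf->; rewrite ?orbF => /eqP.
Qed.

Lemma orb_min j k v (S : G -> Prop) : S v ->
  (forall c w, c \in [:: j; k] -> S w -> S (r c w)) -> forall w, w \in orb j k v -> S w.
Proof.
move=> Sv Sr w /orbP[n _ ->]; elim: n => [//|n IH].
by rewrite walkS; apply: Sr IH; rewrite /letter !inE; case: odd; rewrite eqxx ?orbT.
Qed.

Lemma orb_trans j k j' k' v w : {subset [:: j'; k'] <= [:: j; k]} ->
  w \in orb j k v -> {subset orb j' k' w <= orb j k v}.
Proof.
move=> jk wv; apply: orb_min => // c x /jk; exact: orb_closed.
Qed.

Lemma orb_sym j k v w : w \in orb j k v -> v \in orb j k w.
Proof.
move: w; apply: orb_min; first exact: orb_self.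
move=> c w cjk; apply: (orb_trans (j := j) (k := k) (j' := j) (k' := k)) => //.
by rewrite -{1}(rK c w); apply: orb_closed; rewrite ?orb_self.
Qed.

(** Each of the i.*2 edges around the vertex occurs twice, seen from either of its
    chambers. *)
Definition cell j k v : seq (G * 'I_3) :=
  [seq (w, c) | w <- orb j k v, c <- [:: j; k]].

Lemma mem_cell j k v f : (f \in cell j k v) = (f.1 \in orb j k v) && (f.2 \in [:: j; k]).
Proof.
case: f => w c; apply/allpairsP/andP => [[[w' c'] [w'o c'jk [-> ->]]]|[wo cjk]] //.
by exists (w, c).
Qed.

Variable col : G -> bool.
Hypothesis col_r : forall c v, col (r c v) = ~~ col v.
Hypothesis r_free : forall j k n v, j != k -> 0 < n < i ->
  iter n (fun w => r k (r j w)) v <> v.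

Lemma col_walk j k n v : col (walk j k n v) = col v (+) odd n.
Proof.
elim: n j k v => [|n IH] j k v; first by rewrite addbF.
by rewrite /= IH col_r; case: (col v); case: (odd n).
Qed.

Lemma walk_inj j k v m n : j != k -> m < i.*2 -> n < i.*2 ->
  walk j k m v = walk j k n v -> m = n.
Proof.
move=> jk; wlog lemn : m n / m < n => [H ml nl E|_ nl].
  by have [lt|lt|//] := ltngtP m n; [exact: H|apply/esym/H].
have -> : n = m + (n - m) by lia.
rewrite walk_add; set w := walk j k m v; set d := n - m => E.
have od : ~~ odd d.
  by move/(congr1 col): E; rewrite col_walk; case: (col w); case: (odd d).
have [jk' d0] : letter j k m != letter k j m /\ 0 < d./2 < i.
  by rewrite /letter; split; [case: odd; rewrite // eq_sym|lia].
have := r_free (v := w) jk' d0.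
by rewrite -walk_double even_halfK // -E.
Qed.

Lemma orb_uniq j k v : j != k -> uniq (orb j k v).
Proof.
move=> jk; rewrite map_inj_in_uniq ?iota_uniq // => m n.
by rewrite !mem_iota => ml nl; apply: walk_inj.
Qed.

Lemma cell_uniq j k v : j != k -> uniq (cell j k v).
Proof.
move=> jk; apply: allpairs_uniq; first exact: orb_uniq.
  by rewrite /= inE jk.
by move=> [? ?] [? ?].
Qed.

Lemma size_cell j k v : size (cell j k v) = i.*2.*2.
Proof. by rewrite /cell size_allpairs size_map size_iota muln2. Qed.

Lemma cell_eq j k v f c : j != k -> f \in cell j k v ->
  c \in [:: j; k] -> c != f.2 -> cell f.2 c f.1 =i cell j k v.
Proof.
move=> jk; rewrite mem_cell => /andP[wo fjk] cjk cf g; rewrite !mem_cell.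
have E : [:: f.2; c] =i [:: j; k].
  move=> d; move: fjk cjk cf; rewrite !inE.
  by move=> /orP[]/eqP-> /orP[]/eqP->; rewrite ?eqxx // orbC.
have sE : {subset [:: j; k] <= [:: f.2; c]} by move=> d; rewrite E.
have sE' : {subset [:: f.2; c] <= [:: j; k]} by move=> d; rewrite E.
rewrite E; congr (_ && _); apply/idP/idP; first exact: (orb_trans sE' wo).
apply: (orb_trans sE); have := orb_sym wo.
exact: (orb_trans sE (orb_self _ _ _)).
Qed.

(** An edge lies in two cells; those not contained in E make it a boundary edge. *)
Definition open_cells (E : seq (G * 'I_3)) (f : G * 'I_3) :=
  \sum_(k < 3) ((k != f.2) && ~~ all (mem E) (cell f.2 k f.1)).

Definition perimeter E := \sum_(f <- E) open_cells E f.

(** When more than half of the edges of a cell are present, completing it shortens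
    the boundary: the present edges cease to be exposed to this cell, and the
    fewer new ones are exposed to their other cell only. *)
Lemma fill_cell E j k v : j != k -> uniq E ->
  i.*2 < count (mem E) (cell j k v) -> ~~ all (mem E) (cell j k v) ->
  perimeter (E ++ [seq f <- cell j k v | f \notin E]) < perimeter E.
Proof.
move=> jk uE many nall; set O := cell j k v; set E' := E ++ _.
have uO : uniq O by exact: cell_uniq.
have OE' : {subset O <= E'}.
  by move=> f fO; rewrite mem_cat mem_filter fO andbT orbN.
have EE' : {subset E <= E'} by move=> f fE; rewrite mem_cat fE.
have other f : f \in O -> exists2 c, c != f.2 & cell f.2 c f.1 =i O.
  move=> fO; move: (fO); rewrite mem_cell !inE => /andP[_ fjk].
  have [c cjk cf] : exists2 c, c \in [:: j; k] & c != f.2.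
    case/orP: fjk => /eqP->; last by exists j; rewrite ?mem_head.
    by exists k; rewrite ?inE ?eqxx ?orbT // eq_sym.
  by exists c => //; exact: cell_eq.
have termE f c : nat_of_bool ((c != f.2) && ~~ all (mem E') (cell f.2 c f.1)) <=
                 nat_of_bool ((c != f.2) && ~~ all (mem E) (cell f.2 c f.1)).
  case: (c != f.2) => //=; have [aE|_] := boolP (all (mem E) _).
    by rewrite (sub_all _ aE) // => g; exact: EE'.
  exact: leq_b1.
have oldE f : f \in E -> open_cells E' f + (f \in O) <= open_cells E f.
  move=> fE; have [fO|fO] := boolP (f \in O); last first.
    by rewrite addn0; apply: leq_sum => c _; exact: termE.
  have [c cf cO] := other f fO.
  rewrite /open_cells (bigD1 c) //= [X in _ <= X](bigD1 c) //= cf /=.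
  rewrite (eq_all_r cO) (eq_all_r cO) nall.
  have -> : all (mem E') O by apply/allP.
  by rewrite add0n addnC leq_add2l; apply: leq_sum => d _; exact: termE.
have newE f : f \in O -> open_cells E' f <= 1.
  move=> fO; have [c cf cO] := other f fO.
  rewrite /open_cells (bigD1 c) //= (bigD1 f.2) /=; last by rewrite eq_sym.
  rewrite (eq_all_r cO) eqxx cf /=.
  have -> : all (mem E') O by apply/allP.
  rewrite !add0n; apply: (@leq_trans (\sum_(d < 3 | (d != c) && (d != f.2)) 1)).
    by apply: leq_sum => d _; case: (_ && _).
  rewrite sum1_card.
  have := cardsC [set c; f.2]; rewrite cards2 cf card_ord => -[card1].
  apply: (@leq_trans #|~: [set c; f.2]|); last by rewrite -[X in X <= _]add0n card1.
  by apply/eq_leq/eq_card => d; rewrite !inE negb_or.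
have cntO : \sum_(f <- E) (f \in O) = count (mem E) O.
  rewrite -big_mkcond /= sum1_count.
  rewrite -[LHS]size_filter -[RHS]size_filter; apply/perm_size/uniq_perm.
  - exact: filter_uniq.
  - exact: filter_uniq.
  - by move=> f; rewrite !mem_filter /= andbC.
have S1 : \sum_(f <- E) open_cells E' f + count (mem E) O <= perimeter E.
  rewrite -cntO -big_split /= /perimeter big_seq [X in _ <= X]big_seq.
  by apply: leq_sum => f fE; exact: oldE.
have S2 : \sum_(f <- [seq f <- O | f \notin E]) open_cells E' f <=
          size O - count (mem E) O.
  apply: (@leq_trans (\sum_(f <- [seq f <- O | f \notin E]) 1)).
    rewrite big_seq [X in _ <= X]big_seq; apply: leq_sum => f.
    by rewrite mem_filter => /andP[_ fO]; exact: newE.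
  rewrite sum1_size size_filter -(count_predC (mem E) O) addKn.
  exact/eq_leq/eq_count.
move: S1 S2 many; rewrite /E' /perimeter big_cat /= -/E' /O size_cell; lia.
Qed.

Definition edge_closed (E : seq (G * 'I_3)) :=
  forall v c, (v, c) \in E -> (r c v, c) \in E.

Lemma small_open_cells E0 : uniq E0 -> edge_closed E0 ->
  exists E, [/\ uniq E, edge_closed E, {subset E0 <= E} &
    forall j k v, j != k ->
      all (mem E) (cell j k v) \/ count (mem E) (cell j k v) <= i.*2].
Proof.
have [p] := ubnP (perimeter E0); elim: p E0 => // p IH E0 lep uE cE.
have [[j [k [v [jk nall many]]]]|] := pselect (exists j k v,
  [/\ j != k, ~~ all (mem E0) (cell j k v) & i.*2 < count (mem E0) (cell j k v)]).
  have lt := fill_cell jk uE many nall.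
  have [|||E [uE' cE' sE small]] := IH (E0 ++ [seq f <- cell j k v | f \notin E0]).
  - lia.
  - rewrite cat_uniq uE filter_uniq ?cell_uniq // andbT; apply/hasPn => f.
    by rewrite mem_filter => /andP[].
  - move=> w c; rewrite !mem_cat !mem_filter => /orP[/cE->//|/andP[_ wO]].
    rewrite orbC; case: (_ \in E0) => //=; move: wO.
    by rewrite !mem_cell /= => /andP[wo cjk]; rewrite cjk orb_closed.
  - exists E; split=> // f fE; apply: sE; by rewrite mem_cat fE.
move=> none; exists E0; split=> // j k v jk.
have [?|nall] := boolP (all (mem E0) (cell j k v)); [by left|right].
by rewrite leqNgt; apply/negP => many; apply: none; exists j, k, v.
Qed.

Variable E : seq (G * 'I_3).
Hypothesis E_closed : edge_closed E.
Hypothesis E_small : forall j k v, j != k ->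
  all (mem E) (cell j k v) \/ count (mem E) (cell j k v) <= i.*2.

(** The chambers that can be reached from v around its vertex of type l without
    leaving E. *)
Definition component (l : 'I_3) (v : G) : set G := fun w =>
  forall S : set G, S v ->
    (forall x c, c != l -> S x -> (x, c) \in E -> S (r c x)) -> S w.

Lemma component_self l v : component l v v.
Proof. by []. Qed.

Lemma component_edge l v c : c != l -> (v, c) \in E ->
  component l (r c v) = component l v.
Proof.
move=> cl vcE; apply/funext => w; apply/propext; split=> H S Sv Sr; apply: H => //.
  exact: Sr.
by rewrite -(rK c v); apply: Sr => //; exact: E_closed.
Qed.

Lemma letterNE j k n c : c \in [:: j; k] -> c != letter j k n.+1 -> c = letter j k n.
Proof.
by rewrite /letter !inE /=; case: (odd n) => /orP[]/eqP-> //; rewrite eqxx.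
Qed.

Lemma uphalf_inj m n : uphalf m = uphalf n -> odd m./2 = odd n./2 -> m = n.
Proof. lia. Qed.

Lemma letter_inj j k m n : j != k -> letter j k m = letter j k n -> odd m = odd n.
Proof.
rewrite /letter; case: (odd m); case: (odd n) => // jk Ejk.
  by rewrite Ejk eqxx in jk.
by rewrite Ejk eqxx in jk.
Qed.

(** Around a vertex of a free side, the chambers reachable inside E form a row
    that ends at another free side. The cell is not contained in E as it contains a
    free side; the row has m - 1 of its i.*2 edges, and half of them is
    the most that E may contain, whence m <= i + 1. *)
Lemma wedge v c k l : distinct3 c k l -> (v, c) \notin E ->
  exists m, [/\ 0 < m, m <= i.+1,
    forall w, component l v w <-> exists2 n, n < m & w = walk k c n v,
    (walk k c m.-1 v, letter k c m.-1) \notin E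
  & forall n c', n < m -> c' != l -> (walk k c n v, c') \notin E ->
      (n = 0 /\ c' = c) \/ (n = m.-1 /\ c' = letter k c m.-1)].
Proof.
move=> d vcE; have /and3P[ck kl cl] := d.
have kc : k != c by rewrite eq_sym.
have o1 : odd i.*2.-1 by lia.
have exP : exists n, (walk k c n v, letter k c n) \notin E.
  exists i.*2.-1; apply/negP => /E_closed; rewrite -walkS prednK; last lia.
  by rewrite walk_period /letter o1; exact/negP.
have [m0 m0E m0min] := ex_minnP exP; clear exP.
have edgeE n : n < m0 -> (walk k c n v, letter k c n) \in E.
  by move=> lt; apply: contraLR lt => /m0min; rewrite -leqNgt.
have edgeE' n : n < m0 -> (walk k c n.+1 v, letter k c n) \in E.
  by move=> /edgeE/E_closed; rewrite -walkS.
have m0lt : m0 < i.*2.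
  have : m0 <= i.*2.-1; last lia.
  apply: m0min; apply/negP => /E_closed; rewrite -walkS prednK; last lia.
  by rewrite walk_period /letter o1; exact/negP.
have m0le : m0 <= i.
  have [aE|le] := E_small v kc.
    have : (v, c) \in E.
      by apply: (allP aE); rewrite mem_cell orb_self !inE eqxx orbT.
    by rewrite (negPf vcE).
  rewrite -leq_double; apply: leq_trans le.
  pose f t := (walk k c (uphalf t) v, letter k c t./2).
  have <- : size [seq f t | t <- iota 0 m0.*2] = m0.*2 by rewrite size_map size_iota.
  rewrite -size_filter; apply: uniq_leq_size.
    rewrite map_inj_in_uniq ?iota_uniq // => s t; rewrite !mem_iota => sl tl [E1 E2].
    have half_lt n : n < m0.*2 -> uphalf n < i.*2 by move: m0lt; clear; lia.
    have hst : uphalf s = uphalf t by apply: walk_inj kc _ _ E1; exact: half_lt.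
    exact: uphalf_inj hst (letter_inj kc E2).
  move=> _ /mapP[t + ->]; rewrite mem_iota mem_filter mem_cell /= => tl.
  rewrite walk_orb /f.
  have -> : letter k c t./2 \in [:: k; c].
    by rewrite /letter !inE; case: odd; rewrite eqxx ?orbT.
  rewrite !andbT; have [ot|et] := boolP (odd t).
    have -> : uphalf t = t./2.+1 by lia.
    by apply: edgeE'; lia.
  have -> : uphalf t = t./2 by lia.
  by apply: edgeE; lia.
have ckl c' : c' != l -> c' \in [:: k; c].
  move=> cl'; have [->|->|E'] := distinct3P c' d; rewrite !inE ?eqxx ?orbT //.
  by rewrite E' eqxx in cl'.
exists m0.+1; split=> //.
- move=> w; split=> [H|[n nm ->]]; last first.
    elim: n nm => [_|n IH nm]; first exact: component_self.
    move=> S Sv Sr; rewrite walkS; apply: (Sr); last 1 first.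
    + by apply: edgeE; lia.
    + by rewrite /letter; case: odd.
    + by apply: (IH _ S Sv Sr); exact: ltnW.
  apply: (H (fun w => exists2 n, n < m0.+1 & w = walk k c n v)); first by exists 0.
  move=> _ c' cl' [n nm ->] nE.
  have [E1|ne] := eqVneq c' (letter k c n).
    exists n.+1; last by rewrite walkS -E1.
    rewrite ltnS ltn_neqAle -ltnS nm andbT; apply/eqP => E2.
    by move: m0E; rewrite -E2 -E1 nE.
  case: n => [|n] in nm nE ne *.
    have E2 : c' = c by move: ne (ckl _ cl'); rewrite !inE => /negPf-> /eqP.
    by move: vcE; rewrite -E2 nE.
  exists n; first exact: ltnW.
  by rewrite (letterNE (ckl _ cl') ne) walk_back.
- move=> n c' nm cl' nE; have [E1|ne] := eqVneq c' (letter k c n).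
    right; have nm0 : n = m0; last by rewrite -nm0 -E1.
    have [lt|gt|//] := ltngtP n m0; first by move: nE; rewrite E1 edgeE.
    by move: nm; rewrite ltnS leqNgt gt.
  case: n => [|n] in nm nE ne *.
    by left; split=> //; move: ne (ckl _ cl'); rewrite !inE => /negPf-> /eqP.
  by move: nE; rewrite (letterNE (ckl _ cl') ne) edgeE'.
Qed.

End Tiling.

(** * Seats for new chambers *)

(** The two reflections, up or not, of a row of i places exchange neighbours
    alternately; an end without partner is fixed and is a mirror. Naturals beyond
    the row are fixed. *)
Definition mirror_step (i : nat) (up : bool) (n : nat) : nat :=
  if n < i then
    if odd n (+) up then if n.+1 < i then n.+1 else n else n.-1
  else n.

Section Mirror.
Variable i : nat.

Lemma mirror_stepK up : involutive (mirror_step i up).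
Proof.
move=> n; rewrite /mirror_step; have [lt|ge] := ltnP n i; last first.
  by rewrite ltnNge ge.
have [e|/negPf e] := boolP (odd n (+) up).
  have [lt'|ge'] := ltnP n.+1 i; last by rewrite lt e ltnNge ge'.
  by rewrite lt' /= addNb e.
case: n => [|n] in lt e *; first by rewrite lt e.
by rewrite /= (ltnW lt) lt; move: e; rewrite /= addNb => /negbFE->.
Qed.

(** The place at time w of the walk along the row that is reflected at both
    ends: it has period i.*2, hence the relation satisfied by the row. *)
Definition bounce (w : nat) : nat :=
  let u := w %% i.*2 in if u < i then u else i.*2 - u.+1.

Lemma bounce_small w : w < i -> bounce w = w.
Proof. by move=> lt; rewrite /bounce modn_small ?lt //; lia. Qed.

Lemma bounce_step w : 0 < i ->
  mirror_step i (~~ odd w) (bounce w) = bounce w.+1.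
Proof.
move=> i0; rewrite /bounce /mirror_step.
have -> : odd w = odd (w %% i.*2) by rewrite odd_mod ?odd_double.
have : w.+1 %% i.*2 = (w %% i.*2).+1 %% i.*2 by rewrite -addn1 -modnDml addn1.
have : w %% i.*2 < i.*2 by rewrite ltn_mod; lia.
move: (w %% _) => u lt ->.
have uE : u.+1 %% i.*2 = u.+1 /\ u.+1 < i.*2 \/ u.+1 %% i.*2 = 0 /\ u.+1 = i.*2.
  have [lt'|ge] := ltnP u.+1 i.*2; [left|right]; first by rewrite modn_small.
  have -> : u.+1 = i.*2 by lia.
  by rewrite modnn.
have [wi|wi] := ltnP u i.
  rewrite wi addbN addbb /=.
  case: uE => -[-> E]; last first.
    by have [-> ->] : u = 0 /\ i = 1 by lia.
  by case: ltnP => // ge; lia.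
have -> : i.*2 - u.+1 < i by lia.
have -> : odd (i.*2 - u.+1) (+) ~~ odd u = false.
  by rewrite oddB // odd_double /=; case: (odd u).
case: uE => -[-> E]; first by rewrite ltnNge (leqW wi) /=; lia.
by case: ltnP => ?; lia.
Qed.

Lemma mirror_period up n :
  iter i (fun m => mirror_step i (~~ up) (mirror_step i up m)) n = n.
Proof.
have [ge|lt] := leqP i n.
  have F : forall u, mirror_step i u n = n by move=> u; rewrite /mirror_step ltnNge ge.
  suff H m : iter m (fun m => mirror_step i (~~ up) (mirror_step i up m)) n = n.
    exact: H.
  by elim: m => //= m ->; rewrite !F.
have i0 : 0 < i by lia.
have go w m : odd w = ~~ up ->
  iter m (fun m => mirror_step i (~~ up) (mirror_step i up m)) (bounce w) =
  bounce (w + m.*2).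
  elim: m w => [|m IH] w wo; first by rewrite addn0.
  have E2 := bounce_step w.+1 i0; have E1 := bounce_step w i0.
  rewrite /= wo ?negbK in E1 E2; rewrite iterSr E1 E2 IH /= ?wo ?negbK //.
  by rewrite doubleS !addnS !addSn.
have per w : bounce (w + i.*2) = bounce w by rewrite /bounce modnDr.
have [on|on] := boolP (odd n == ~~ up).
  by have := go n i (eqP on); rewrite per bounce_small.
have := go (i.*2 - n.+1) i; rewrite per.
have -> : bounce (i.*2 - n.+1) = n.
  rewrite /bounce modn_small; last lia.
  by case: ltnP => ?; lia.
apply; rewrite oddB ?odd_double /=; last lia.
by move: on; case: (odd n); case: (up).
Qed.

End Mirror.

Section Universe.
Variables (G : eqType) (r : 'I_3 -> G -> G) (i : nat).
Hypothesis rK : forall c, involutive (r c).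
Hypothesis r_period : forall j k v, iter i (fun w => r k (r j w)) v = v.

(** A seat is a chamber of the surface with a component of the piece around
    one of its vertices, or a place on a row. Recording the component gives each
    component its own copy of the cell, so that different components
    around one vertex do not get in each other's way. A row is named
    by a free side or, when created later, by a number; it also
    carries the colour crossed between its places 0 and 1. *)
Definition seat : choiceType :=
  {classic (G * set G) + ((G * 'I_3) + nat) * 'I_3 * nat}.

Definition real_seat (v : G) (K : set G) : seat := inl (v, K).
Definition row_seat (nm : (G * 'I_3) + nat) (c0 : 'I_3) (n : nat) : seat :=
  inr (nm, c0, n).

Definition seat_step (c : 'I_3) (a : seat) : seat :=
  match a with
  | inl (v, K) => real_seat (r c v) K
  | inr (nm, c0, n) => row_seat nm c0 (mirror_step i (c == c0) n)
  end.

Definition level (a : seat) : nat :=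
  match a with inr (inr B, _, _) => B | _ => 0 end.

Definition owner (a : seat) : option ((G * 'I_3) + nat) :=
  match a with inr (nm, _, _) => Some nm | _ => None end.

Lemma seat_stepK c : involutive (seat_step c).
Proof.
case=> [[v K]|[[nm c0] n]] /=; first by rewrite /real_seat rK.
by rewrite /row_seat mirror_stepK.
Qed.

Lemma seat_period j k a : j != k -> iter i (fun b => seat_step k (seat_step j b)) a = a.
Proof.
move=> jk; case: a => [[v K]|[[nm c0] n]].
  have E m : iter m (fun b => seat_step k (seat_step j b)) (real_seat v K) =
    real_seat (iter m (fun w => r k (r j w)) v) K.
    by elim: m => // m IH; rewrite !iterS IH.
  by rewrite E r_period.
rewrite -[LHS]/(iter i _ (row_seat nm c0 n)).
have E m : iter m (fun b => seat_step k (seat_step j b)) (row_seat nm c0 n) =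
  row_seat nm c0 (iter m (fun p => mirror_step i (k == c0) (mirror_step i (j == c0) p)) n).
  by elim: m => // m IH; rewrite !iterS IH.
rewrite E; congr row_seat.
have [jc|jc] := eqVneq j c0.
  by rewrite -jc eq_sym (negPf jk) -[false]/(~~ true) mirror_period.
have [kc|kc] := eqVneq k c0; first by rewrite -[true]/(~~ false) mirror_period.
suff H m : iter m (fun p => mirror_step i false (mirror_step i false p)) n = n.
  exact: H.
by elim: m => // m IH; rewrite iterS IH mirror_stepK.
Qed.

Lemma mirror_walk_down nm c0 n k l : n < i -> (k == c0) = odd n -> (l == c0) = ~~ odd n ->
  mirror_walk seat_step k l (row_seat nm c0 n) [seq row_seat nm c0 m | m <- rev (iota 0 n)].
Proof.
elim: n k l => [|n IH] k l lt kE lE.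
  by rewrite /= kE /mirror_step lt.
rewrite -addn1 iotaD rev_cat /=; split.
  by rewrite addn1 kE /mirror_step lt addbb.
apply: IH; [exact: ltnW|by rewrite lE /= negbK|by rewrite kE].
Qed.

Lemma mirror_walk_up nm c0 n m k l : n + m + 1 = i -> (k == c0) = odd n -> (l == c0) = ~~ odd n ->
  mirror_walk seat_step l k (row_seat nm c0 n) [seq row_seat nm c0 p | p <- iota n.+1 m].
Proof.
elim: m n k l => [|m IH] n k l nm_i kE lE /=.
  rewrite lE /mirror_step addbN addbb /=; congr row_seat.
  have -> : (n.+1 < i) = false by lia.
  by rewrite if_same.
split.
  rewrite lE /mirror_step addbN addbb /=; congr row_seat.
  have [-> ->] : n < i /\ n.+1 < i by lia.
  by [].
by apply: IH; rewrite ?kE ?lE //=; lia.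
Qed.

(** The place n of a row leaves n places below and m above it; the first colour of
    the row is chosen so that k leads downwards. *)
Lemma mirrored_row nm j k l n m : distinct3 j k l -> n + m + 1 = i ->
  exists x w w', [/\ mirror_walk seat_step k l x w, mirror_walk seat_step l k x w',
    size w = n, size w' = m
    & uniq (x :: w ++ w') /\ forall a, a \in x :: w ++ w' -> owner a = Some nm].
Proof.
move=> /and3P[_ kl _] nmi; pose c0 := if odd n then k else l.
have kE : (k == c0) = odd n by rewrite /c0; case: odd; rewrite ?eqxx // (negPf kl).
have lE : (l == c0) = ~~ odd n.
  by rewrite /c0; case: odd; rewrite ?eqxx //= eq_sym (negPf kl).
exists (row_seat nm c0 n), [seq row_seat nm c0 p | p <- rev (iota 0 n)],
       [seq row_seat nm c0 p | p <- iota n.+1 m]; split.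
- by apply: mirror_walk_down => //; lia.
- exact: mirror_walk_up.
- by rewrite size_map size_rev size_iota.
- by rewrite size_map size_iota.
rewrite -map_cat -map_cons; split; last by move=> _ /mapP[p _ ->].
rewrite map_inj_uniq; last by move=> p q [].
rewrite /= cat_uniq rev_uniq !iota_uniq mem_cat mem_rev !mem_iota /= andbT.
apply/andP; split; first by lia.
by apply/hasPn => p; rewrite mem_iota mem_rev mem_iota; lia.
Qed.

Lemma fresh_row j k l n m B : distinct3 j k l -> n + m + 1 = i ->
  exists x w w', [/\ mirror_walk seat_step k l x w, mirror_walk seat_step l k x w',
    size w = n, size w' = m
    & uniq (x :: w ++ w') /\ all (fun a => level a == B) (x :: w ++ w')].
Proof.
move=> d nmi; have [x [w [w' [tw tw' sw sw' [u ow]]]]] := mirrored_row (inr B) d nmi.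
exists x, w, w'; split=> //; split=> //; apply/allP => a /ow.
by case: a => [[]//|[[nm c0] p]] /= [->].
Qed.

Hypothesis i_ge6 : 6 <= i.

(** If the first colour of a row is j, which does not act on seats of type j,
    the two colours that act there act in the same way: both fix the place 0 and
    both exchange the places 1 and 2. *)
Lemma fresh_one j k l B : distinct3 j k l ->
  exists x, [/\ seat_step k x = x, seat_step l x = x & level x = B].
Proof.
move=> /and3P[jk kl jl]; exists (row_seat (inr B) j 0).
rewrite /= ![_ == j]eq_sym (negPf jk) (negPf jl) /mirror_step.
by have -> : 0 < i by lia.
Qed.

Lemma fresh_bigon j k l B : distinct3 j k l ->
  exists x y, [/\ seat_step k x = y, seat_step l x = y, x != y,
                  level x = B & level y = B].
Proof.
move=> /and3P[jk kl jl]; exists (row_seat (inr B) j 1), (row_seat (inr B) j 2).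
rewrite /= ![_ == j]eq_sym (negPf jk) (negPf jl) /mirror_step /=.
have [-> ->] : 1 < i /\ 2 < i by lia.
by split=> //; apply/eqP => -[].
Qed.

End Universe.

(** * Completion of a finite piece of a tiling *)

Lemma distinct3_flip j k l : distinct3 j k l -> distinct3 k j l.
Proof. by rewrite /distinct3 [k == j]eq_sym => /and3P[-> -> ->]. Qed.

Lemma gap_size i m : 6 <= i -> 0 < m -> m <= i.+1 ->
  exists n, [/\ 0 < n, n + m + 2 = i.*2, odd n = ~~ odd m.-1 & n.+2 = i.*2 - m].
Proof. by move=> i6 m0 mi; exists (i.*2 - m - 2); split; lia. Qed.

Lemma gap_arith i n m p q : n + m + 2 = i.*2 -> p < n -> q < m ->
  [/\ p.+2 <= i.*2, i.*2 - p.+2 < i.*2, q < i.*2 & i.*2 - p.+2 <> q].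
Proof. by move=> nm pn qm; split; lia. Qed.

Lemma gap_arith' i n m p : n + m + 2 = i.*2 -> p < n -> p.+1 < i.*2 /\ n.+1 < i.*2.
Proof. by move=> nm pn; split; lia. Qed.

Section Completion.
Variables (G : eqType) (r : 'I_3 -> G -> G) (i : nat) (col : G -> bool).
Hypothesis i_ge6 : 6 <= i.
Hypothesis rK : forall c, involutive (r c).
Hypothesis r_period : forall j k v, iter i (fun w => r k (r j w)) v = v.
Hypothesis col_r : forall c v, col (r c v) = ~~ col v.
Hypothesis r_free : forall j k n v, j != k -> 0 < n < i ->
  iter n (fun w => r k (r j w)) v <> v.
Variable E : seq (G * 'I_3).
Hypothesis E_closed : edge_closed r E.
Hypothesis E_small : forall j k v, j != k ->
  all (mem E) (cell r i j k v) \/ count (mem E) (cell r i j k v) <= i.*2.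

Local Notation seat := (seat G).
Local Notation step := (seat_step r i).
Local Notation comp := (component r E).
Local Notation real_seat := (@real_seat G).
Local Notation chamber := (chamber seat).
Local Notation solvable := (@solvable seat step (@level G)).

Let i_gt0 : 0 < i. Proof. exact: leq_trans i_ge6. Qed.

(** The chamber glued on the free side e gets a place on a row of its own, which it
    cuts into two balanced parts. *)
Lemma tip_exists (e : G * 'I_3) : exists xw : seat * ('I_3 -> seq seat),
  [/\ forall k l, distinct3 e.2 k l ->
        [/\ mirror_walk step k l xw.1 (xw.2 k), balanced i (col e.1) (size (xw.2 k)),
            uniq (xw.1 :: xw.2 k) & forall a, a \in xw.2 k -> a \notin xw.2 l],
      owner xw.1 = Some (inl e) &
      forall k a, a \in xw.2 k -> owner a = Some (inl e)].
Proof.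
have [k [l d]] : exists k l, distinct3 e.2 k l.
  case: e => v [[|[|[|//]]] h] /=.
  - by exists (Ordinal (isT : 1 < 3)), (Ordinal (isT : 2 < 3)).
  - by exists (Ordinal (isT : 0 < 3)), (Ordinal (isT : 2 < 3)).
  - by exists (Ordinal (isT : 0 < 3)), (Ordinal (isT : 1 < 3)).
have [n [m [nmi bn bm]]] := balanced_split i_ge6 (col e.1).
have [x [w [w' [tw tw' sw sw' [/= /andP[xww' uww'] ow]]]]] :=
  mirrored_row r (inl e) d nmi.
move: xww' uww'; rewrite mem_cat negb_or cat_uniq => /andP[xw xw'] /and3P[uw ww' uw'].
have ww'N a : a \in w -> a \notin w' by move=> aw; apply: contra ww' => aw'; apply/hasP; exists a.
have w'wN a : a \in w' -> a \notin w by move=> aw; apply: contra ww' => aw'; apply/hasP; exists a.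
have /and3P[ek kl el] := d.
exists (x, fun c => if c == k then w else w'); split=> /=; last 1 first.
- by move=> c a; case: eqP => _ aw; apply: ow; rewrite inE mem_cat aw ?orbT.
- move=> k' l' d'; have /and3P[ek' kl' el'] := d'.
  have [E1|E1|E1] := distinct3P k' d; first by rewrite E1 eqxx in ek'.
    rewrite E1 eqxx.
    have [E2|E2|E2] := distinct3P l' d; first by rewrite E2 eqxx in el'.
      by rewrite E1 E2 eqxx in kl'.
    by rewrite E2 eq_sym (negPf kl) xw uw sw.
  rewrite E1 eq_sym (negPf kl).
  have [E2|E2|E2] := distinct3P l' d; first by rewrite E2 eqxx in el'.
    by rewrite E2 eqxx xw' uw' sw'.
  by rewrite E1 E2 eqxx in kl'.
- by apply: ow; rewrite mem_head.
Qed.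

Definition tip (e : G * 'I_3) : seat := (projT1 (cid (tip_exists e))).1.
Definition tail (e : G * 'I_3) : 'I_3 -> seq seat := (projT1 (cid (tip_exists e))).2.

Lemma tailP e k l : distinct3 e.2 k l ->
  [/\ mirror_walk step k l (tip e) (tail e k), balanced i (col e.1) (size (tail e k)),
      uniq (tip e :: tail e k) & forall a, a \in tail e k -> a \notin tail e l].
Proof. by rewrite /tip /tail; case: cid => xw /= [H _ _] /H. Qed.

Lemma owner_tip e : owner (tip e) = Some (inl e).
Proof. by rewrite /tip; case: cid => xw []. Qed.

Lemma owner_tail e k a : a \in tail e k -> owner a = Some (inl e).
Proof. by rewrite /tail; case: cid => xw /= [_ _ H] /H. Qed.

(** In each of its three cells, a chamber of the piece sits on the copy given by
    its own component. *)
Definition place (v : G) : chamber := [ffun l => real_seat v (comp l v)].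

(** The chamber glued on the free side e: next to [place e.1] in the two cells at the
    ends of the side, and on the row of e at the opposite vertex. *)
Definition flap (e : G * 'I_3) : chamber :=
  [ffun m => if m == e.2 then tip e else real_seat (r e.2 e.1) (comp m e.1)].

Definition verts : seq G := undup [seq f.1 | f <- E].
Definition sides : seq (G * 'I_3) :=
  [seq e <- [seq (v, c) | v <- verts, c <- enum 'I_3] | e \notin E].
Definition start : seq chamber := [seq place v | v <- verts] ++ [seq flap e | e <- sides].

Lemma mem_sides v c : ((v, c) \in sides) = (v \in verts) && ((v, c) \notin E).
Proof.
rewrite mem_filter andbC; congr (_ && _).
apply/allpairsP/idP => [[[w d] /= [wV _ [-> _]]]|vV] //.
by exists (v, c); rewrite mem_enum.
Qed.

Lemma verts_edge v c : (v, c) \in E -> v \in verts.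
Proof. by move=> vE; rewrite mem_undup; apply/mapP; exists (v, c). Qed.

Lemma component_verts l v w : v \in verts -> comp l v w -> w \in verts.
Proof.
move=> vV /(_ (fun x => x \in verts)); apply=> // x c _ _ /E_closed; exact: verts_edge.
Qed.

Lemma component_eq l v w : comp l v w -> comp l w = comp l v.
Proof.
move=> /(_ (fun x => comp l x = comp l v)); apply=> // x c cl xE vE.
by rewrite (component_edge rK E_closed cl vE).
Qed.

Let wedgeP v c k l (d : distinct3 c k l) (vE : (v, c) \notin E) :=
  wedge i_gt0 rK r_period col_r r_free E_closed E_small d vE.

Let winj j k v m n : j != k -> m < i.*2 -> n < i.*2 ->
  walk r j k m v = walk r j k n v -> m = n.
Proof. exact: (walk_inj i_gt0 col_r r_free). Qed.

Lemma third_colour (c l : 'I_3) : c != l -> exists k, distinct3 c k l.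
Proof.
case: c l => [[|[|[|//]]] h] [[|[|[|//]]] h'] // _.
- by exists (Ordinal (isT : 2 < 3)).
- by exists (Ordinal (isT : 1 < 3)).
- by exists (Ordinal (isT : 2 < 3)).
- by exists (Ordinal (isT : 0 < 3)).
- by exists (Ordinal (isT : 1 < 3)).
- by exists (Ordinal (isT : 0 < 3)).
Qed.

Lemma step_last c k v : r c v = walk r k c i.*2.-1 v.
Proof.
rewrite -[LHS]/(walk r c k 1 v) (walk_rev i_gt0 rK r_period); last lia.
by rewrite subn1.
Qed.

(** Going around the vertex, the chamber across the free side comes last, far
    beyond the at most i + 1 chambers of the component. *)
Lemma component_neighbour v c l : c != l -> (v, c) \notin E -> ~ comp l v (r c v).
Proof.
move=> cl vE; have [k d] := third_colour cl.
have [m [m0 mi compE _ _]] := wedgeP d vE; move=> /compE[n nm].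
have /and3P[ck _ _] := d.
rewrite (step_last c k) => H; suff : i.*2.-1 = n by lia.
by apply: (winj _ _ _ H); rewrite 1?eq_sym //; lia.
Qed.

(** A row has only two free sides, and it is too short for them to face the same
    missing chamber. *)
Lemma side_inj v c v' c' l : c != l -> c' != l -> (v, c) \notin E -> (v', c') \notin E ->
  comp l v = comp l v' -> r c v = r c' v' -> (v, c) = (v', c').
Proof.
move=> cl cl' vE vE' Ecomp Er; have [k d] := third_colour cl.
have [m [m0 mi compE _ free]] := wedgeP d vE; have /and3P[ck _ _] := d.
have [n nm v'E] : exists2 n, n < m & v' = walk r k c n v.
  by apply/compE; rewrite Ecomp; exact: component_self.
rewrite v'E in vE'; have [[n0 c'E]|[nE c'E]] := free n c' nm cl' vE'.
  by rewrite c'E v'E n0.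
move: Er; rewrite v'E nE c'E -walkS prednK // (step_last c k) => H.
suff : i.*2.-1 = m by lia.
by apply: (winj _ _ _ H); rewrite 1?eq_sym //; lia.
Qed.

Lemma place_seat v l : place v l = real_seat v (comp l v).
Proof. by rewrite ffunE. Qed.

Lemma flap_tip e : flap e e.2 = tip e.
Proof. by rewrite ffunE eqxx. Qed.

Lemma flap_seat e l : l != e.2 -> flap e l = real_seat (r e.2 e.1) (comp l e.1).
Proof. by rewrite ffunE => /negPf->. Qed.

Lemma start_real z l w K : z \in start -> z l = real_seat w K ->
  [/\ z = place w, w \in verts & K = comp l w] \/
  exists e, [/\ z = flap e, e \in sides, l != e.2, w = r e.2 e.1 & K = comp l e.1].
Proof.
rewrite mem_cat => /orP[]/mapP[x xV ->].
  by rewrite place_seat => -[<- <-]; left.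
have [lE|ne] := eqVneq l x.2.
  by rewrite lE flap_tip => /(congr1 (@owner G)); rewrite owner_tip.
by rewrite flap_seat // => -[<- <-]; right; exists x.
Qed.

Lemma start_row z l nm : z \in start -> owner (z l) = Some nm ->
  exists e, [/\ z = flap e, e \in sides, l = e.2 & nm = inl e].
Proof.
rewrite mem_cat => /orP[]/mapP[x xV ->]; first by rewrite place_seat.
have [lE|ne] := eqVneq l x.2; last by rewrite flap_seat.
by rewrite lE flap_tip owner_tip => -[<-]; exists x.
Qed.

Lemma sides_notin e : e \in sides -> e \notin E.
Proof. by rewrite mem_filter => /andP[]. Qed.

(** A seat determines its component; by the two previous lemmas the chamber or the
    free side is then known too. *)
Lemma start_inj : coord_inj start.
Proof.
move=> z z' l zS z'S zz'; case zl : (z l) => [[w K]|[[nm c0] n]].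
  have z'l : z' l = real_seat w K by rewrite -zz'.
  have [[-> wV KE]|[[v c] /= [zE eS lc wE KE]]] := start_real zS zl.
    have [[-> //]|[[v' c'] /= [zE' eS' lc' wE' KE']]] := start_real z'S z'l.
    have := sides_notin eS'; rewrite eq_sym in lc' => /(component_neighbour lc') [].
    by rewrite -KE' -wE' KE; exact: component_self.
  rewrite eq_sym in lc; have nE := sides_notin eS.
  have [[_ wV KE']|[[v' c'] /= [zE' eS' lc' wE' KE']]] := start_real z'S z'l.
    case: (component_neighbour lc nE).
    by rewrite -KE -wE KE'; exact: component_self.
  rewrite eq_sym in lc'; rewrite zE zE'; congr flap.
  apply: (side_inj lc lc' nE (sides_notin eS')); first by rewrite -KE.
  by rewrite -wE.
have own : owner (z l) = Some nm by rewrite zl.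
have own' : owner (z' l) = Some nm by rewrite -zz'.
have [e [-> _ _ E1]] := start_row zS own.
have [e' [-> _ _ E2]] := start_row z'S own'.
by move: E2; rewrite E1 => -[->].
Qed.

Lemma chain_walk_seats j k v K n :
  chain_walk step j k (real_seat v K) [seq real_seat (walk r j k m.+1 v) K | m <- iota 0 n]
    (real_seat (walk r j k n.+1 v) K) (letter j k n).
Proof.
elim: n j k v => [//|n IH] j k v.
rewrite -[iota 0 n.+1]/(0 :: iota 1 n) map_cons /=; split=> //.
rewrite (iotaDl 1 0) -map_comp.
have -> : letter j k n.+1 = letter k j n by rewrite /letter /=; case: odd.
exact: IH.
Qed.

(** The sides of glued chambers to be closed along the cell copy (l, K). *)
Definition wedge_flags (l : 'I_3) (K : set G) (z : chamber) (c : 'I_3) : Prop :=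
  exists e, [/\ e \in sides, z = flap e, distinct3 e.2 c l & comp l e.1 = K].

(** The seats that this may use: those of the cell copy, and the rows of the
    glued chambers on their sides that face it. *)
Definition wedge_reserve (l : 'I_3) (K : set G) (c : 'I_3) (a : seat) : Prop :=
  (c = l /\ exists w, a = real_seat w K) \/
  exists e k, [/\ a \in tail e k, e \in sides, c = e.2, distinct3 e.2 k l & comp l e.1 = K].

(** The row of v has m <= i + 1 chambers, and its cell copy contains the two
    chambers glued at its ends. The i.*2 - m - 2 > 0 seats that remain form a
    chain between these two. *)
Lemma wedge_solvable v c k l : (v, c) \in sides -> distinct3 c k l ->
  exists R, [/\ forall c' a, R c' a -> wedge_reserve l (comp l v) c' a,
    forall z c', z \in start -> ~ R c' (z c')
  & solvable (fun z => z \in start) R (wedge_flags l (comp l v))].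
Proof.
move=> eS d; have nE := sides_notin eS; have /and3P[ck kl cl] := d.
have [m [m0 mi compE endE free]] := wedgeP d nE.
have vV : v \in verts by move: eS; rewrite mem_sides => /andP[].
set v' := walk r k c m.-1 v in endE; set c' := letter k c m.-1 in endE.
have v'comp : comp l v v' by apply/compE; exists m.-1; rewrite // prednK.
have e'S : (v', c') \in sides by rewrite mem_sides endE (component_verts vV v'comp).
have Ecomp := component_eq v'comp.
set K := comp l v in Ecomp *.
have [n [n0 nm on n2]] := gap_size i_ge6 m0 mi.
have m2i : m <= i.*2 by rewrite -nm -addnA addnCA leq_addr.
pose s := [seq real_seat (walk r k c p.+1 (r c v)) K | p <- iota 0 n].
have flapl : flap (v, c) l = real_seat (r c v) K by rewrite flap_seat // eq_sym.
pose c'' := letter k c n.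
have c'l : c' != l by rewrite /c' /letter; case: odd.
have d' : distinct3 c'' c' l.
  rewrite /distinct3 c'l /c' /c'' /letter.
  rewrite on; by case: odd; rewrite /= ?ck ?kl ?cl // eq_sym ck.
have flapl' : flap (v', c') l = real_seat (walk r k c n.+1 (r c v)) K.
  rewrite flap_seat 1?eq_sym //= Ecomp; congr (real_seat _ K).
  rewrite -walkS prednK // -[RHS]/(walk r c k n.+2 v).
  by rewrite n2; exact: (walk_rev i_gt0 rK r_period).
have dk := distinct3_flip d.
have dt : distinct3 (v, c).2 k l by [].
have dt' : distinct3 (v', c').2 c'' l by exact: distinct3_flip d'.
have [tt bt ut _] := tailP dt; have [tt' bt' ut' _] := tailP dt'.
have sided e : e \in sides -> e.2 != l -> comp l e.1 = K -> e = (v, c) \/ e = (v', c').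
  case: e => w b /= wS bl wK.
  have [p pm wE] : exists2 p, p < m & w = walk r k c p v.
    by apply/compE; rewrite -/K -wK; exact: component_self.
  have := sides_notin wS; rewrite wE => wnE.
  by have [[-> ->]|[-> ->]] := free p b pm bl wnE; [left|right].
have ends_neq : (v, c) <> (v', c').
  have kc : k != c by rewrite eq_sym.
  have m1 : m.-1 < i.*2 by apply: leq_trans m2i; rewrite prednK.
  move=> -[vE' cE]; have E0 : 0 = m.-1 by apply: (@winj k c v) => //; rewrite double_gt0.
  by move: cE ck; rewrite /c' -E0 /letter /= => ->; rewrite eqxx.
have gap_notin p : p < n -> ~ comp l v (walk r k c p.+1 (r c v)).
  move=> pn /compE[q qm]; have [p2 p2i qi neq] := gap_arith nm pn qm.
  rewrite -[LHS]/(walk r c k p.+2 v) (walk_rev i_gt0 rK r_period) // => H.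
  by apply: neq; apply: winj H; rewrite // eq_sym.
exists (reserve3 l c c' s (tail (v, c) k) (tail (v', c') c'')); split.
- move=> b a [[-> /mapP[p _ ->]]|[-> aW]|[-> aW]].
  + by left; split=> //; eexists.
  + by right; exists (v, c), k; split.
  + by right; exists (v', c'), c''; split.
- move=> z b zS [[-> /mapP[p]]|[bE aW]|[bE aW]].
  + rewrite mem_iota => /= pn zl.
    have [[_ _ KE]|[e [_ eS' le wE KE]]] := start_real zS zl.
      by apply: (gap_notin p pn); rewrite -/K KE; exact: component_self.
    have [pi ni] := gap_arith' nm pn.
    have el : e.2 != l by rewrite eq_sym.
    have [eE|eE] := sided e eS' el (esym KE).
      have : walk r k c 0 (r c v) = walk r k c p.+1 (r c v) by rewrite [RHS]wE eE.
      by move/winj => H; have := H _ _ pi; rewrite eq_sym ck double_gt0 i_gt0 => /(_ isT isT).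
    have : real_seat (walk r k c n.+1 (r c v)) K = real_seat (walk r k c p.+1 (r c v)) K.
      rewrite [walk r k c p.+1 _]wE eE -flapl' flap_seat; last by rewrite eq_sym.
      by rewrite Ecomp.
    case=> /winj H; have np := H ck (ltnW ni) (ltnW pi).
    by move: pn; rewrite np ltnn.
  + have [e [zE eS' bE' [E1]]] := start_row zS (owner_tail aW).
    move: aW; rewrite bE zE -E1 -[X in flap _ X]/((v, c).2) flap_tip => aW.
    by move: ut; rewrite /= aW.
  + have [e [zE eS' bE' [E1]]] := start_row zS (owner_tail aW).
    move: aW; rewrite bE zE -E1 -[X in flap _ X]/((v', c').2) flap_tip => aW.
    by move: ut'; rewrite /= aW.
- have kc : k != c by rewrite eq_sym.
  apply: (@solvable_sub _ _ _ (fun z => z = flap (v, c) \/ z = flap (v', c')) _ _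
    (fun z b => single_side (flap (v, c)) k z b \/ single_side (flap (v', c')) c'' z b)).
  + move=> z [->|->]; rewrite /= mem_cat; apply/orP; right; exact: map_f.
  + move=> z b [e [eS' -> de Ke]]; have /and3P[_ _ el] := de.
    have [eE|eE] := sided e eS' el Ke; [left|right]; rewrite eE /= in de *.
      split=> //; have [E1|//|E1] := distinct3P b d.
        by move: de; rewrite E1 /distinct3 eqxx.
      by move: de; rewrite E1 /distinct3 eqxx andbF.
    split=> //; have [//|E1|E1] := distinct3P b d'.
      by move: de; rewrite E1 /distinct3 eqxx.
    by move: de; rewrite E1 /distinct3 eqxx andbF.
  apply: (@chain_solvable seat step (@level G) i (seat_stepK i rK) (@fresh_row G r i)
    (@fresh_one G r i i_ge6) (@fresh_bigon G r i i_ge6) (balanced i) (balanced_gt0 i_ge6)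
    (balanced_step i_ge6) (balanced_fillable i_ge6) s k c l _ _ c'' c' _ _ (col v)) => //.
  + by rewrite -size_eq0 size_map size_iota -lt0n.
  + rewrite map_inj_in_uniq ?iota_uniq // => p q; rewrite !mem_iota /= => pn qn [H].
    have [pi _] := gap_arith' nm pn; have [qi _] := gap_arith' nm qn.
    by have [] := winj kc pi qi H.
  + by rewrite flapl flapl'; exact: chain_walk_seats.
  + by rewrite -[X in flap _ X]/((v, c).2) flap_tip.
  + by rewrite -[X in flap _ X]/((v', c').2) flap_tip.
  + by case/andP: ut.
  + by case/andP: ut'.
  + move=> _ a /owner_tail o1; apply/negP => /owner_tail; rewrite o1 => -[].
    by move=> E1 E2; apply: ends_neq; rewrite -E1 -E2.
  + move: bt'; rewrite /= (col_walk col_r) size_map size_iota on negbK.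
    by [].
Qed.

Lemma level_owned a e : owner a = Some (inl e) -> @level G a = 0.
Proof. by case: a => [//|[[[?|?] ?] ?]]. Qed.

Lemma wedge_reserve_level l K c a : wedge_reserve l K c a -> @level G a = 0.
Proof. by case=> [[_ [w ->]] //|[e [k [/owner_tail/level_owned]]]]. Qed.

Lemma wedge_reserve_inj l K l' K' c a : wedge_reserve l K c a ->
  wedge_reserve l' K' c a -> (l, K) = (l', K').
Proof.
case=> [[-> [w ->]]|[e [k [ak _ ce d Ke]]]].
  case=> [[-> [w' [_ ->]]] //|[e [k [/owner_tail //]]]].
case=> [[_ [w aw]]|[e' [k' [ak' _ _ d' Ke']]]].
  by move: (owner_tail ak); rewrite aw.
have ee' : e' = e by move: (owner_tail ak); rewrite (owner_tail ak') => -[].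
subst e'; have /and3P[ek kl el] := d; have /and3P[ek' kl' el'] := d'.
have kk' : k' = k.
  apply/eqP; apply: contraT => kk'.
  have dk : distinct3 e.2 k k' by rewrite /distinct3 ek ek' eq_sym kk'.
  by have [_ _ _ /(_ a ak)] := tailP dk; rewrite ak'.
have ll' : l' = l.
  have [E1|E1|//] := distinct3P l' d; first by rewrite E1 eqxx in el'.
  by rewrite E1 kk' eqxx in kl'.
by rewrite -Ke -Ke' ll'.
Qed.

Definition wedge_index (t : 'I_3 * {classic (set G)}) :=
  exists v c k, [/\ (v, c) \in sides, distinct3 c k t.1 & t.2 = comp t.1 v].

Lemma wedges_solvable (ts : seq ('I_3 * {classic (set G)})) : uniq ts ->
  (forall t, t \in ts -> wedge_index t) ->
  exists R, [/\ forall c a, R c a -> exists2 t, t \in ts & wedge_reserve t.1 t.2 c a,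
    forall z c, z \in start -> ~ R c (z c)
  & solvable (fun z => z \in start) R
      (fun z c => exists2 t, t \in ts & wedge_flags t.1 t.2 z c)].
Proof.
elim: ts => [_ _|[l K] ts IH /= /andP[nt uts] tsP].
  exists (fun _ _ => False); split; [by []|by move=> ? ? _|move=> Z B _ [injZ _ _]].
  by apply: completes_nil => // z c [].
have [t tts|R [RP Rstart SR]] := IH uts; first by apply: tsP; rewrite inE tts orbT.
have [v [c [k [vS d /= KE]]]] := tsP (l, K) (mem_head _ _); subst K.
have [R1 [R1P R1start SR1]] := wedge_solvable vS d.
exists (fun c a => R1 c a \/ R c a); split.
- move=> b a [/R1P H|/RP[t tts H]].
    by exists (l, comp l v); rewrite ?mem_head.
  by exists t => //; rewrite inE tts orbT.
- by move=> z b zS [/R1start|/Rstart]; apply.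
- apply: (solvable_sub _ _ (solvable_cat _ SR1 SR)) => //.
    move=> z b [t]; rewrite inE => /orP[/eqP-> /=|tts H]; [by left|right].
    by exists t.
  move=> b a /R1P H1 /RP[t tts H2]; have tE := wedge_reserve_inj H1 H2.
  by move: nt; rewrite tE -surjective_pairing tts.
Qed.

Lemma closed_completion : exists Z : seq {ffun 'I_3 -> seat},
  [/\ coord_inj Z, {subset start <= Z} & forall z c, z \in Z -> resolved step Z z c].
Proof.
pose ts : seq ('I_3 * {classic (set G)}) := undup
  [seq (l, comp l e.1 : {classic (set G)}) | e <- sides, l <- [seq l <- enum 'I_3 | l != e.2]].
have tsP e l : e \in sides -> l != e.2 -> (l, comp l e.1 : {classic (set G)}) \in ts.
  move=> eS le; rewrite mem_undup; apply/allpairsPdep; exists e, l.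
  by split=> //; rewrite mem_filter le mem_enum.
have [|t|R [RP Rstart S]] := @wedges_solvable ts; first exact: undup_uniq.
  rewrite mem_undup => /allpairsPdep[[v c] [l [eS + ->]]].
  rewrite mem_filter /= => /andP[lc _]; rewrite eq_sym in lc.
  by have [k d] := third_colour lc; exists v, c, k.
(* the seats used so far have level 0 *)
have V : valid (@level G) start 1 R.
  split=> [|z c zS|c a /RP[t _]]; first exact: start_inj.
    split; last exact: Rstart.
    case zc: (z c) => [//|[[nm c0] n]]; have own : owner (z c) = Some nm by rewrite zc.
    have [e [_ _ _ nmE]] := start_row zS own.
    by rewrite -zc (level_owned (e := e)) // own nmE.
  by move/wedge_reserve_level->.
have [//|N [B [_ injN resN flagN]]] := S start 1 _ V.
exists (N ++ start); split=> //.
  by move=> z zS; rewrite mem_cat zS orbT.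
have up z : z \in start -> z \in N ++ start by move=> zS; rewrite mem_cat zS orbT.
have placeS v : v \in verts -> place v \in start.
  by move=> vV; rewrite mem_cat map_f.
have flapS e : e \in sides -> flap e \in start.
  by move=> eS; rewrite mem_cat orbC map_f.
have side_adj v c : adjacent step c (place v) (flap (v, c)).
  by move=> l lc; rewrite place_seat flap_seat.
move=> z c; rewrite mem_cat => /orP[/(resN _ c)[]//|].
rewrite mem_cat => /orP[]/mapP[].
  move=> v vV ->; have [vE|vE] := boolP ((v, c) \in E).
    exists (place (r c v)); first exact/up/placeS/verts_edge/E_closed.
    move=> l lc; rewrite !place_seat /= (component_edge rK E_closed _ vE) //.
    by rewrite eq_sym.
  exists (flap (v, c)); last exact: side_adj.
  by apply/up/flapS; rewrite mem_sides vV.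
move=> [v d] eS ->; have [->|cd] := eqVneq c d.
  exists (place v); first by apply/up/placeS; move: eS; rewrite mem_sides => /andP[].
  exact/(adjacent_sym (seat_stepK i rK))/side_adj.
have dc : d != c by rewrite eq_sym.
have [l /distinct3_swap dl] := third_colour dc.
have /and3P[_ _ dl'] := dl.
apply: flagN; exists (l, comp l v); first by apply: (tsP (v, d)) => //=; rewrite eq_sym.
by exists (v, d).
Qed.

(** The crossings are defined on the closed family; their relations can be checked
    on a single coordinate, since a seat determines its chamber. *)
Theorem finite_completion v0 c0 : (v0, c0) \in E ->
  exists (Q : finType) (s : 'I_3 -> Q -> Q) (f : G -> Q),
  [/\ forall c, involutive (s c),
      forall j k q, j != k -> iter i (fun x => s k (s j x)) q = q,
      {in verts &, injective f}
    & forall v c, (v, c) \in E -> s c (f v) = f (r c v)].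
Proof.
move=> v0E; have [Z [injZ startZ resZ]] := closed_completion.
have next_ex (x : 'I_3 * seq_sub Z) :
    exists y : seq_sub Z, adjacent step x.1 (val x.2) (val y).
  have [z zZ adj] := resZ (val x.2) x.1 (valP x.2).
  by exists (SeqSub zZ).
have [next nextP] := choice next_ex.
pose s c q := next (c, q); have sP c q : adjacent step c (val q) (val (s c q)).
  exact: (nextP (c, q)).
have placeZ v : v \in verts -> place v \in Z.
  by move=> vV; apply: startZ; rewrite mem_cat map_f.
pose f v : seq_sub Z := insubd (SeqSub (placeZ _ (verts_edge v0E))) (place v).
have fE v : v \in verts -> val (f v) = place v.
  by move=> vV; rewrite /f val_insubd placeZ.
have other (c : 'I_3) : exists m, m != c.
  by case: c => [[|m] h]; [exists (Ordinal (isT : 1 < 3))|exists (Ordinal (isT : 0 < 3))].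
have seatI (q q' : seq_sub Z) m : val q m = val q' m -> q = q'.
  by move=> qq'; apply/val_inj/(injZ _ _ m) => //; exact: valP.
exists (seq_sub Z), s, f; split.
- move=> c q; have [m mc] := other c; apply: (seatI _ _ m).
  by rewrite -(sP c (s c q) m mc) -(sP c q m mc) seat_stepK.
- move=> j k q jk; have [l d] := third_colour jk.
  move: d; rewrite /distinct3 => /and3P[jl lk _]; apply: (seatI _ _ l).
  rewrite -[RHS](@seat_period G r i r_period j k _ jk).
  elim: {1 2}i q => [//|n IH] q; rewrite !iterSr IH; congr iter.
  by rewrite -(sP k) // -(sP j) // eq_sym.
- move=> v w vV wV fvw; have : place v = place w by rewrite -!fE // fvw.
  by move/(congr1 (fun z : chamber => z ord0)); rewrite !place_seat => -[].
- move=> v c vE; have [m mc] := other c; apply: (seatI _ _ m).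
  rewrite -(sP c (f v) m mc) !fE ?(verts_edge vE) //; last exact/verts_edge/E_closed/vE.
  rewrite !place_seat /= (component_edge rK E_closed _ vE) //.
  by rewrite eq_sym.
Qed.

End Completion.

(** * Morphisms from presented groups *)

Local Open Scope group_scope.
Local Open Scope classical_set_scope.

(** A term of type {multiplicative G -> G'} carries compatibility with
    products only. *)
Lemma morph_one (G G' : groupType) (f : {multiplicative G -> G'}) : f 1 = 1.
Proof. by apply: (mulgI (f 1)); rewrite -gmulfM !mulg1. Qed.

Lemma morph_exp (G G' : groupType) (f : {multiplicative G -> G'}) x n : f (x ^+ n) = f x ^+ n.
Proof. by elim: n => [|n IH]; rewrite ?expg0 ?morph_one // !expgS gmulfM IH. Qed.

Lemma morph_inv (G G' : groupType) (f : {multiplicative G -> G'}) x : f x^-1 = (f x)^-1.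
Proof. by apply: (mulgI (f x)); rewrite -gmulfM !mulgV morph_one. Qed.

Section NclLift.
Variables (G : groupType) (R : set (G : Type)) (G' : groupType) (f : {multiplicative G -> G'}).
Hypothesis fR : forall x, R x -> f x = 1.

Lemma normal_closure_ker x : normal_closure R x -> f x = 1.
Proof.
move=> /(_ [set y | f y = 1]); apply; split; last by move=> y /fR.
split.
  split; first by rewrite inE /= morph_one.
  by move=> y z; rewrite !inE /= gmulfM morph_inv => -> ->; rewrite invg1 mulg1.
by move=> y z /= fy; rewrite conjgE !gmulfM fy mul1g -gmulfM mulVg morph_one.
Qed.

Definition ncl_lift (a : ncl_quot R) : G' := f (repr a).

Lemma ncl_lift_proj x : ncl_lift (ncl_proj R x) = f x.
Proof.
have : ncl_proj R (repr (ncl_proj R x)) = ncl_proj R x by exact: reprK.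
move/ncl_projP/normal_closure_ker; rewrite gmulfM morph_inv => E.
by apply: (mulIg (f x)^-1); rewrite /ncl_lift E mulgV.
Qed.

Lemma ncl_lift_morph : {morph ncl_lift : x y / x * y}.
Proof.
elim/ncl_ind=> x; elim/ncl_ind=> y.
by rewrite -ncl_proj_morph !ncl_lift_proj gmulfM.
Qed.

HB.instance Definition _ := isMultiplicative.Build _ _ ncl_lift ncl_lift_morph.

Lemma ncl_lift_exists : exists g : {multiplicative ncl_quot R -> G'},
  forall x, g (ncl_proj R x) = f x.
Proof. by exists ncl_lift; exact: ncl_lift_proj. Qed.

End NclLift.

Section Triangle.
Variable i : nat.
Local Notation H := (triangle_group i).

Lemma tri_rel x : triangle_relators i x -> ncl_proj (triangle_relators i) x = 1.
Proof.
move=> Rx; apply/ncl_projP; rewrite invg1 mulg1; exact: normal_closure_sub.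
Qed.

Lemma tri_aX : tri_a i ^+ i = 1.
Proof.
by rewrite /tri_a -morph_exp /= tri_rel //; left; left.
Qed.

Lemma tri_bX : tri_b i ^+ i = 1.
Proof. by rewrite /tri_b -morph_exp /= tri_rel //; left; right. Qed.

Lemma tri_abX : (tri_a i * tri_b i) ^+ i = 1.
Proof. by rewrite /tri_a /tri_b -ncl_proj_morph -morph_exp /= tri_rel //; right. Qed.

Lemma triangle_lift (G' : groupType) (x y : G') :
  x ^+ i = 1 -> y ^+ i = 1 -> (x * y) ^+ i = 1 ->
  exists f : {multiplicative H -> G'}, f (tri_a i) = x /\ f (tri_b i) = y.
Proof.
move=> xi yi xyi; pose g : {multiplicative free_group bool -> G'} := free_lift (fun l : bool => if l then x else y).
have gR r : triangle_relators i r -> g r = 1.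
  by move=> [[]|] ->; rewrite morph_exp ?gmulfM /= !free_lift_gen.
have [f fE] := ncl_lift_exists gR.
by exists f; rewrite /tri_a /tri_b !fE /= !free_lift_gen.
Qed.

Definition tri_gen (l : bool) : H := if l then tri_a i else tri_b i.

Hypothesis i_gt0 : 0 < i.

(** The generators have finite order, so their inverses are positive words. *)
Lemma triangle_word (h : H) : exists u : seq bool, h = \prod_(l <- u) tri_gen l.
Proof.
pose W (h : H) := exists u : seq bool, h = \prod_(l <- u) tri_gen l.
have WM x y : W x -> W y -> W (x * y).
  by move=> [u ->] [v ->]; exists (u ++ v); rewrite big_cat.
have W1 : W 1 by exists [::]; rewrite big_nil.
have Wg l : W (tri_gen l) by exists [:: l]; rewrite big_seq1.
have WV l : W (tri_gen l)^-1.
  have -> : (tri_gen l)^-1 = tri_gen l ^+ i.-1.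
    apply: (mulgI (tri_gen l)); rewrite mulgV -expgS prednK //.
    by case: l; rewrite ?tri_aX ?tri_bX.
  by elim: i.-1 => [|n IH]; rewrite ?expg0 // expgS; exact: WM.
elim/ncl_ind: h => g; elim/free_ind: g => u.
elim: u => [|[l e] u IH].
  exact: W1.
rewrite -cat1s -free_mul_pi.
rewrite (ncl_proj_morph (triangle_relators i) (\pi_(free_group bool)%qT [:: (l, e)])).
apply: WM IH; have : W (if e then tri_gen l else (tri_gen l)^-1) by case: e.
suff -> : (if e then tri_gen l else (tri_gen l)^-1) =
   ncl_proj (triangle_relators i) (\pi_(free_group bool)%qT [:: (l, e)]) by [].
case: e; first by case: l.
have -> : \pi_(free_group bool)%qT [:: (l, false)] = (gen (l : bool))^-1.
  by rewrite [RHS](free_inv_pi [:: (l, true)]).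
by rewrite (morph_inv (ncl_proj (triangle_relators i))) /=; case: l.
Qed.

End Triangle.

(** * Finite extensions of partial actions of the triangle group *)

Section PartialAction.
Variable i : nat.
Hypothesis i_ge6 : 6 <= i.
Local Notation H := (triangle_group i).
Local Notation a := (tri_a i).
Local Notation b := (tri_b i).
Variables (X : eqType) (act : X -> H -> X).
Hypothesis act1 : forall x, act x 1 = x.
Hypothesis actM : forall x g h, act x (g * h) = act (act x g) h.
Hypothesis act_free : forall x n g, [\/ g = a, g = b | g = a * b] -> 0 < n < i ->
  act x (g ^+ n) <> x.

(** The quotients of these three elements are a, b, a b and their inverses. *)
Definition shift (c : 'I_3) : H :=
  if val c is c'.+1 then (if c' is _.+1 then b^-1 else a) else 1.

(** Each point of the H-set is a white chamber (true) and a black one (false); a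
    side joins chambers of different colours. *)
Definition flip (c : 'I_3) (v : X * bool) : X * bool :=
  if v.2 then (act v.1 (shift c), false) else (act v.1 (shift c)^-1, true).

Lemma flipK c : involutive (flip c).
Proof. by case=> x []; rewrite /flip /= -actM ?mulgV ?mulVg act1. Qed.

Lemma flip_colour c v : (flip c v).2 = ~~ v.2.
Proof. by case: v => x []. Qed.

Lemma iter_flip j k n x :
  iter n (fun v => flip k (flip j v)) (x, true) =
  (act x ((shift j / shift k) ^+ n), true).
Proof.
elim: n x => [|n IH] x; first by rewrite expg0 act1.
by rewrite iterSr /flip /= -actM IH expgS -actM.
Qed.

Lemma iter_flip_swap j k n v :
  iter n (fun v => flip k (flip j v)) (flip j v) =
  flip j (iter n (fun v => flip j (flip k v)) v).
Proof.
elim: n => // n IH; by rewrite !iterS IH !flipK.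
Qed.

Lemma shift_pair (j k : 'I_3) : j != k ->
  exists2 g, [\/ g = a, g = b | g = a * b] & shift j / shift k = g \/ shift j / shift k = g^-1.
Proof.
have aP : [\/ a = a, a = b | a = a * b] by constructor 1.
have bP : [\/ b = a, b = b | b = a * b] by constructor 2.
have abP : [\/ a * b = a, a * b = b | a * b = a * b] by constructor 3.
case: j k => [[|[|[|//]]] h] [[|[|[|//]]] h'] //= _; rewrite /shift /= ?invgK ?invg1 ?mulg1 ?mul1g.
- by exists a => //; right.
- by exists b => //; left.
- by exists a => //; left.
- by exists (a * b) => //; left.
- by exists b => //; right.
- by exists (a * b) => //; right; rewrite invgM.
Qed.

Lemma tri_genX g : [\/ g = a, g = b | g = a * b] -> g ^+ i = 1.
Proof. by case=> ->; [exact: tri_aX|exact: tri_bX|exact: tri_abX]. Qed.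

Lemma flip_period j k v : iter i (fun w => flip k (flip j w)) v = v.
Proof.
have shiftX j' k' : (shift j' / shift k') ^+ i = 1.
  have [->|jk] := eqVneq j' k'; first by rewrite mulgV expg1n.
  have [g /tri_genX gi [->|->]] := shift_pair jk; first by [].
  by rewrite expVgn gi invg1.
case: v => x [|]; first by rewrite iter_flip shiftX act1.
rewrite -(flipK j (x, false)) iter_flip_swap {2}/flip /=.
by rewrite iter_flip shiftX act1.
Qed.

Lemma flip_free j k n v : j != k -> 0 < n < i ->
  iter n (fun w => flip k (flip j w)) v <> v.
Proof.
move=> jk ni.
have free j' k' x : j' != k' -> act x ((shift j' / shift k') ^+ n) <> x.
  move=> jk'; have [g gP [->|->]] := shift_pair jk'; first exact: act_free.
  rewrite expVgn => E; apply: (act_free (x := x) gP ni).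
  by rewrite -{1}E -actM mulVg act1.
case: v => x [|]; first by rewrite iter_flip => -[/(free _ _ _ jk)].
rewrite -(flipK j (x, false)) iter_flip_swap {2}/flip /=.
move/(can_inj (flipK j)); rewrite iter_flip => -[].
by apply: free; rewrite eq_sym.
Qed.

Definition side0 : 'I_3 := Ordinal (isT : 0 < 3).
Definition side1 : 'I_3 := Ordinal (isT : 1 < 3).
Definition side2 : 'I_3 := Ordinal (isT : 2 < 3).

(** The chambers over S and all their sides are a finite piece of the tiling, and
    in its completion a and b act by crossing two sides in succession. *)
Lemma partial_action (S : seq X) (x0 : X) : x0 \in S ->
  exists (Q : finType) (psi : {multiplicative H -> {perm Q}}) (f : X -> Q),
    {in S &, injective f} /\
    forall x l, x \in S -> act x (tri_gen i l) \in S ->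
      psi (tri_gen i l) (f x) = f (act x (tri_gen i l)).
Proof.
move=> x0S; have i0 : 0 < i by exact: leq_trans i_ge6.
pose E0 := undup (flatten [seq [:: ((x, true), c); (flip c (x, true), c)] |
                           x <- S, c <- enum 'I_3]).
have E0_in x c : x \in S -> ((x, true), c) \in E0 /\ (flip c (x, true), c) \in E0.
  move=> xS; rewrite !mem_undup; split; apply/flattenP;
    exists [:: ((x, true), c); (flip c (x, true), c)];
    rewrite ?inE ?eqxx ?orbT //; apply/allpairsP; exists (x, c); rewrite mem_enum.
    by [].
  by [].
have cE0 : edge_closed flip E0.
  move=> v c; rewrite mem_undup => /flattenP[_ /allpairsP[[x d] /= [xS _ ->]]].
  rewrite !inE => /orP[]/eqP[-> ->]; first exact: (E0_in x d xS).2.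
  by rewrite flipK; exact: (E0_in x d xS).1.
have [E [uE cE sE small]] := small_open_cells i0 flipK flip_period
  flip_colour flip_free (undup_uniq _) cE0.
have v0E : ((x0, true), side0) \in E by apply: sE; exact: (E0_in x0 side0 x0S).1.
have [Q [s [f [sK s_period f_inj sf]]]] := finite_completion i_ge6 flipK flip_period
  flip_colour flip_free cE small v0E.
(* permutations act on the right, so a crosses side 1 first and then side 0 *)
pose comp j k := perm (inj_comp (inv_inj (sK k)) (inv_inj (sK j))).
have compE j k q : comp j k q = s k (s j q) by rewrite permE.
have compX j k n q : (comp j k ^+ n) q = iter n (fun q => s k (s j q)) q.
  elim: n q => [|n IH] q; first by rewrite expg0 perm1.
  by rewrite expgS permM iterSr IH compE.
have comp_period j k : j != k -> comp j k ^+ i = 1.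
  by move=> jk; apply/permP => q; rewrite compX s_period // perm1.
have comp_ab : comp side1 side0 * comp side0 side2 = comp side1 side2.
  by apply/permP => q; rewrite permM !compE sK.
have [|||psi [psia psib]] := @triangle_lift i {perm Q} (comp side1 side0) (comp side0 side2).
- exact: comp_period.
- exact: comp_period.
- by rewrite comp_ab; exact: comp_period.
have edge x c : x \in S -> s c (f (x, true)) = f (flip c (x, true)).
  by move=> xS; apply: sf; apply: sE; exact: (E0_in x c xS).1.
have edge' x c : x \in S -> s c (f (flip c (x, true))) = f (x, true).
  move=> xS; rewrite -[X in _ = f X](flipK c (x, true)).
  by apply: sf; apply: sE; exact: (E0_in x c xS).2.
exists Q, psi, (fun x => f (x, true)); split.
  move=> x y xS yS /f_inj H; suff [] : (x, true) = (y, true) by [].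
  by apply: H; apply: (@verts_edge _ _ _ side0); apply: sE; apply: (E0_in _ side0 _).1.
move=> x [] xS xlS; rewrite /tri_gen ?psia ?psib compE.
  rewrite (edge x) // -[RHS](edge' _ side0) //; congr (s side0 (f _)).
  by rewrite /flip /= act1.
rewrite (edge x) // -[RHS](edge' _ side2) //; congr (s side2 (f _)).
by rewrite /flip /= act1 -actM mulgV act1.
Qed.

End PartialAction.

(** * Finitely generated subgroups of the triangle group *)

Lemma free_word_ind (X : Type) (Q : free_group X -> Prop) : Q 1 ->
  (forall g x e, Q g -> Q ((if e then gen x else (gen x)^-1) * g)) -> forall g, Q g.
Proof.
move=> Q1 QM; elim/free_ind=> u; elim: u => [|[x e] u IH]; first exact: Q1.
rewrite -cat1s -free_mul_pi; have := QM _ x e IH.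
suff -> : (if e then gen x else (gen x)^-1) = \pi_(free_group X)%qT [:: (x, e)] by [].
by case: e => //; rewrite [LHS](free_inv_pi [:: (x, true)]).
Qed.

Section Separability.
Variable i : nat.
Hypothesis i_ge6 : 6 <= i.
Local Notation H := (triangle_group i).
Let i_gt0 : 0 < i. Proof. exact: leq_trans i_ge6. Qed.

Definition torus : finGroupType := ('Z_i * 'Z_i)%type.

Lemma torus_exp (z : torus) n : z ^+ n = (z.1 ^+ n, z.2 ^+ n).
Proof. by elim: n => [|n IH] //; rewrite !expgS IH. Qed.

Lemma Zp1_exp n : (Zp1 : 'Z_i) ^+ n = 1 -> i %| n.
Proof.
move/eqP; rewrite -order_dvdn order_Zp1 Zp_cast //; exact: leq_trans i_ge6.
Qed.

Lemma Zp1X : (Zp1 : 'Z_i) ^+ i = 1.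
Proof.
apply/eqP; rewrite -order_dvdn order_Zp1 Zp_cast //; exact: leq_trans i_ge6.
Qed.

(** The abelianisation shows that a, b and a b have order exactly i. *)
Lemma torus_character : exists chi : {multiplicative H -> torus},
  forall g n, [\/ g = tri_a i, g = tri_b i | g = tri_a i * tri_b i] ->
    0 < n < i -> chi (g ^+ n) <> 1.
Proof.
pose x : torus := (Zp1, 1); pose y : torus := (1, Zp1).
have [|||chi [chia chib]] := @triangle_lift i torus x y.
- by rewrite torus_exp /= Zp1X expg1n.
- by rewrite torus_exp /= Zp1X expg1n.
- by rewrite torus_exp /= mulg1 mul1g Zp1X.
exists chi => g n gP /andP[n0 ni]; rewrite morph_exp torus_exp => -[E1 E2].
suff : i %| n by move/(dvdn_leq n0); rewrite leqNgt ni.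
case: gP => gE; rewrite gE ?gmulfM ?chia ?chib /= ?mulg1 ?mul1g in E1 E2.
- exact: Zp1_exp E1.
- exact: Zp1_exp E2.
- exact: Zp1_exp E1.
Qed.

Definition translate (P : set (H : Type)) (h : H) : set (H : Type) :=
  [set z | P (z * h^-1)].

(** Let L be the image under emb of the kernel of psi. In the action of H on its
    subsets by right translation, the image of emb permutes the sets
    emb (psi^-1 q), of which L is the one with q = 1. Hence the paths that
    spell the images of the generators and start at one of these finitely many sets
    remain in a finite set S. Extending the action on S, enlarged by the path
    that spells h from L, to a finite set Q gives rho: the elements of L fix the point L,
    and h does not. The factor torus only serves to make the orbits of a,
    b and a b consist of exactly i points. *)
Lemma triangle_separable (Y : Type) (s : seq {classic Y})
    (emb : {multiplicative free_group Y -> H})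
    (Q0 : finGroupType) (psi : {multiplicative free_group Y -> Q0}) (h : H) :
  (forall y : {classic Y}, y \in s) -> (forall w, psi w = 1 -> h <> emb w) ->
  exists (Q : finGroupType) (rho : {multiplicative H -> Q}),
    forall w, psi w = 1 -> rho h <> rho (emb w).
Proof.
move=> s_all hker; have [chi chi_free] := torus_character.
pose X : eqType := ({classic (set (H : Type))} * torus)%type.
pose act (x : X) (g : H) : X := (translate x.1 g, x.2 * chi g).
have act1 x : act x 1 = x.
  case: x => P t; rewrite /act morph_one mulg1; congr pair.
  by apply/funext => z; rewrite /translate /= invg1 mulg1.
have actM x g g' : act x (g * g') = act (act x g) g'.
  rewrite /act gmulfM mulgA; congr pair.
  by apply/funext => z; rewrite /translate /= invgM mulgA.
have act_free x n g : [\/ g = tri_a i, g = tri_b i | g = tri_a i * tri_b i] ->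
  0 < n < i -> act x (g ^+ n) <> x.
  move=> gP ni /(congr1 snd) /= E; apply: (chi_free g n gP ni).
  by apply: (mulgI x.2); rewrite mulg1.
pose eval (u : seq bool) := \prod_(l <- u) tri_gen i l.
have [word wordP] := choice (triangle_word i_gt0).
pose words := word h :: [seq word (emb (if e then gen y else (gen y)^-1)) |
                         y <- s, e <- [:: true; false]].
pose fibre (q : Q0) : {classic (set (H : Type))} :=
  [set z | exists2 w, psi w = q & z = emb w].
have fibre_act q t w : act (fibre q, t) (emb w) = (fibre (q * psi w), t * chi (emb w)).
  congr pair; apply/funext => z; apply/propext; split=> /=.
    move=> [w' <- E]; exists (w' * w); first by rewrite gmulfM.
    by rewrite gmulfM -E mulgVK.
  move=> [w' E ->]; exists (w' * w^-1); last by rewrite gmulfM morph_inv.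
  by rewrite gmulfM morph_inv E mulgK.
pose starts : seq X := [seq (fibre q, t) | q <- enum Q0, t <- enum torus].
pose prefixes := flatten [seq [seq take n u | n <- iota 0 (size u).+1] | u <- words].
pose S : seq X := [seq act x (eval v) | x <- starts, v <- prefixes].
have S_in q t u n : u \in words -> n <= size u ->
    act (fibre q, t) (eval (take n u)) \in S.
  move=> uW nu; apply/allpairsP; exists ((fibre q, t) : X, take n u); split=> //.
    by apply/allpairsP; exists (q, t); rewrite !mem_enum.
  apply/flattenP; exists [seq take n u | n <- iota 0 (size u).+1]; first by apply/mapP; exists u.
  by apply/mapP; exists n; rewrite // mem_iota.
have hW : word h \in words by exact: mem_head.
have gW y e : word (emb (if e then gen y else (gen y)^-1)) \in words.
  rewrite /words in_cons; apply/orP; right.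
  apply/(@allpairsP {classic Y} bool); exists (y : {classic Y}, e); split=> //.
  by case: e.
have base_in : act (fibre 1, 1) (eval (take 0 (word h))) \in S by exact: S_in.
have [Q [rho [f [f_inj f_act]]]] := partial_action i_ge6 act1 actM act_free base_in.
have along q t u n : u \in words -> n <= size u ->
    rho (eval (take n u)) (f (fibre q, t)) = f (act (fibre q, t) (eval (take n u))).
  move=> uW; elim: n => [|n IH] nu.
    by rewrite take0 /eval big_nil morph_one perm1 act1.
  have E : eval (take n.+1 u) = eval (take n u) * tri_gen i (nth true u n).
    by rewrite (take_nth true nu) /eval -cats1 big_cat big_seq1.
  rewrite E gmulfM permM IH; last exact: ltnW.
  rewrite f_act ?actM //; first exact: (S_in _ _ _ _ uW (ltnW nu)).
  by rewrite -actM -E; exact: S_in.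
have along_word q t u : u \in words ->
    rho (eval u) (f (fibre q, t)) = f (act (fibre q, t) (eval u)).
  by move=> uW; have := along q t u (size u) uW (leqnn _); rewrite take_size.
have along_emb w : forall q t,
    rho (emb w) (f (fibre q, t)) = f (act (fibre q, t) (emb w)).
  elim/free_word_ind: w => [|g y e IH] q t; first by rewrite !morph_one perm1 act1.
  rewrite !gmulfM permM actM.
  have := along_word q t _ (gW y e); rewrite /eval -wordP => ->.
  by rewrite fibre_act IH.
exists {perm Q}, rho => w psiw rho_eq.
have Eh : rho h (f (fibre 1, 1)) = f (act (fibre 1, 1) h).
  by have := along_word 1 1 _ hW; rewrite /eval -wordP.
have hS : act (fibre 1, 1) h \in S.
  by have := S_in 1 1 _ _ hW (leqnn _); rewrite take_size /eval -wordP.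
have wS : act (fibre 1, 1) (emb w) \in S.
  rewrite fibre_act psiw mulg1.
  have := S_in 1 (1 * chi (emb w)) _ 0 hW (leq0n _).
  by rewrite take0 /eval big_nil act1.
have := f_inj _ _ hS wS; rewrite -Eh rho_eq along_emb => /(_ erefl).
rewrite fibre_act psiw mulg1 => /(congr1 fst) /= Efib.
have : (fibre 1 : set (H : Type)) h.
  rewrite -Efib /translate /= mulgV; exists 1; rewrite ?morph_one //.
by move=> [w' /hker + hE]; apply.
Qed.

End Separability.

(** * Words in an HNN extension *)

(** Domain and range of a partial injection have the same size, and so do their
    complements. *)
Lemma perm_of_partial (T : finType) (D : T -> T -> Prop) :
  (forall x y y', D x y -> D x y' -> y = y') ->
  (forall x x' y, D x y -> D x' y -> x = x') ->
  exists s : {perm T}, forall x y, D x y -> s x = y.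
Proof.
move=> Dfun Dinj.
pose A := [set x | `[< exists y, D x y >]]%SET.
pose B := [set y | `[< exists x, D x y >]]%SET.
have [f fP] : exists f : T -> T, forall x, x \in A -> D x (f x).
  have : forall x, exists y, x \in A -> D x y.
    move=> x; have [|nA] := boolP (x \in A); last by exists x.
    by rewrite inE => /asboolP[y Dxy]; exists y.
  by move=> /choice[f fP]; exists f.
have f_inj : {in A &, injective f}.
  by move=> x x' /fP Dx /fP Dx' E; apply: (Dinj _ _ (f x)); rewrite // E.
have fAB : [set f x | x in A]%SET = B.
  apply/setP => y; apply/imsetP/idP => [[x xA ->]|].
    by rewrite inE; apply/asboolP; exists x; exact: fP.
  rewrite inE => /asboolP[x Dxy]; exists x; first by rewrite inE; apply/asboolP; exists y.
  by apply: (Dfun x _ _ Dxy); apply: fP; rewrite inE; apply/asboolP; exists y.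
have cAB : #|~: A| = #|~: B|.
  by have := cardsC A; have := cardsC B; rewrite -fAB card_in_imset //; lia.
have [g [g_inj gP]] : exists g : T -> T,
    {in ~: A &, injective g} /\ forall x, x \in ~: A -> g x \in ~: B.
  have [->|[y0 y0B]] := set_0Vmem (~: A); first by exists id; split=> // x; rewrite inE.
  exists (fun x => nth y0 (enum (~: B)) (index x (enum (~: A)))); split.
    move=> x x' xA x'A /eqP; rewrite nth_uniq ?enum_uniq -?cardE -?cAB ?cardE ?index_mem ?mem_enum //.
    by move=> /eqP E; rewrite -(nth_index y0 (s := enum (~: A)) (x := x)) ?mem_enum // E nth_index ?mem_enum.
  by move=> x xA; rewrite -mem_enum mem_nth // -cardE -cAB cardE index_mem mem_enum.
pose h x := if x \in A then f x else g x.
have h_inj : injective h.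
  move=> x x'; rewrite /h; case: ifPn => xA; case: ifPn => x'A.
  - exact: f_inj.
  - have : f x \in B by rewrite -fAB imset_f.
    have := gP x'; rewrite inE x'A => /(_ isT); rewrite inE => /negP nB fB E.
    by case: nB; rewrite -E.
  - have : f x' \in B by rewrite -fAB imset_f.
    have := gP x; rewrite inE xA => /(_ isT); rewrite inE => /negP nB fB E.
    by case: nB; rewrite E.
  - by apply: g_inj; rewrite inE.
exists (perm h_inj) => x y Dxy; rewrite permE /h.
have xA : x \in A by rewrite inE; apply/asboolP; exists y.
by rewrite xA; apply: (Dfun x _ _ _ Dxy); exact: fP.
Qed.

Section HNNLift.
Variables (H : groupType) (K : set (H : Type)) (phi : H -> H).
Local Notation G := (hnn K phi).

Definition hnn_base (h : H) : G := ncl_proj (hnn_relators K phi) (hnn_elt h).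
Definition hnn_t : G := ncl_proj (hnn_relators K phi) (hnn_stable H).

Lemma hnn_baseM h h' : hnn_base (h * h') = hnn_base h * hnn_base h'.
Proof.
rewrite /hnn_base -ncl_proj_morph; apply/esym/ncl_projP.
by apply: normal_closure_sub; left; exists (h, h').
Qed.

HB.instance Definition _ := isMultiplicative.Build _ _ hnn_base hnn_baseM.

Lemma hnn_conj k : K k -> hnn_t * hnn_base k * hnn_t^-1 = hnn_base (phi k).
Proof.
move=> Kk; rewrite /hnn_base /hnn_t.
have -> : (ncl_proj (hnn_relators K phi) (hnn_stable H))^-1 =
  ncl_proj (hnn_relators K phi) (hnn_stable H)^-1 by rewrite -morph_inv.
rewrite -(ncl_proj_morph _ (hnn_stable H) (hnn_elt k)).
rewrite -(ncl_proj_morph _ (hnn_stable H * hnn_elt k)); apply/ncl_projP.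
by apply: normal_closure_sub; right; exists k.
Qed.

Lemma hnn_lift (G' : groupType) (f : {multiplicative H -> G'}) (t : G') :
  (forall k, K k -> t * f k * t^-1 = f (phi k)) ->
  exists g : {multiplicative G -> G'}, (forall h, g (hnn_base h) = f h) /\ g hnn_t = t.
Proof.
move=> ft; pose g0 : {multiplicative free_group (H + unit) -> G'} :=
  free_lift (fun x : H + unit => if x is inl h then f h else t).
have gR r : hnn_relators K phi r -> g0 r = 1.
  case=> [[[h h'] _ <-]|[k Kk <-]].
    by rewrite !(gmulfM, morph_inv) /= !free_lift_gen gmulfM mulgV.
  by rewrite !(gmulfM, morph_inv) /= !free_lift_gen ft // mulgV.
have [g gE] := ncl_lift_exists gR.
by exists g; split=> [h|]; rewrite /hnn_base /hnn_t gE /= free_lift_gen.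
Qed.

Definition stable_pow (e : bool) : G := if e then hnn_t else hnn_t^-1.

Definition hnn_word (h : H) (w : seq (bool * H)) : G :=
  hnn_base h * \prod_(x <- w) (stable_pow x.1 * hnn_base x.2).

Lemma hnn_word_cat h w w' : hnn_word h (w ++ w') =
  hnn_word h w * \prod_(x <- w') (stable_pow x.1 * hnn_base x.2).
Proof. by rewrite /hnn_word big_cat mulgA. Qed.

Lemma hnn_wordP g : exists h w, g = hnn_word h w.
Proof.
elim/ncl_ind: g => u; elim/free_word_ind: u => [|u x e [h [w IH]]].
  exists 1, [::]; rewrite /hnn_word big_nil mulg1 [RHS]morph_one.
  exact: (morph_one (ncl_proj (hnn_relators K phi))).
have E : ncl_proj (hnn_relators K phi) (if e then gen x else (gen x)^-1) =
   (if x is inl h' then hnn_base (if e then h' else h'^-1) else stable_pow e).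
  case: x => [h'|[]]; case: e; rewrite ?(morph_inv (ncl_proj _)) ?morph_inv //=.
rewrite ncl_proj_morph IH E; case: x {E} => [h'|[]].
  by exists ((if e then h' else h'^-1) * h), w; rewrite /hnn_word hnn_baseM mulgA.
by exists 1, ((e, h) :: w); rewrite /hnn_word big_cons morph_one mul1g mulgA.
Qed.

End HNNLift.

(** * Residual finiteness of HNN extensions *)

Definition separable (H : groupType) (K : set (H : Type)) : Prop :=
  forall h, ~ K h -> exists (Q : finGroupType) (f : {multiplicative H -> Q}),
    forall k, K k -> f h <> f k.

Section PairMorphism.
Variables (H G1 G2 : groupType) (f1 : {multiplicative H -> G1}) (f2 : {multiplicative H -> G2}).
Definition pair_morphism (h : H) : (G1 * G2)%type := (f1 h, f2 h).
Lemma pair_morphismM : {morph pair_morphism : x y / x * y}.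
Proof. by move=> x y; rewrite /pair_morphism !gmulfM. Qed.
HB.instance Definition _ := isMultiplicative.Build _ _ pair_morphism pair_morphismM.
End PairMorphism.

Section TrivialMorphism.
Variables (H G : groupType).
Definition trivial_morphism (h : H) : G := 1.
Lemma trivial_morphismM : {morph trivial_morphism : x y / x * y}.
Proof. by move=> x y; rewrite /trivial_morphism mulg1. Qed.
HB.instance Definition _ := isMultiplicative.Build _ _ trivial_morphism trivial_morphismM.
End TrivialMorphism.

Lemma separable_list (H : groupType) (K : set (H : Type)) (hs : seq H) :
  separable K -> (forall h, h \in hs -> ~ K h) ->
  exists (Q : finGroupType) (f : {multiplicative H -> Q}),
    forall h k, h \in hs -> K k -> f h <> f k.
Proof.
move=> sepK; elim: hs => [_|h hs IH hsK].
  by exists {perm 'I_0}; exists (@trivial_morphism H ({perm 'I_0} : groupType)).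
have [|Q [f fP]] := IH; first by move=> h' h'hs; apply: hsK; rewrite inE h'hs orbT.
have [Q' [f' f'P]] := sepK h (hsK h (mem_head _ _)).
exists (Q' * Q)%type, (pair_morphism f' f) => h1 k + Kk.
rewrite inE => /orP[/eqP->|h1hs] [E1 E2]; first exact: (f'P k).
exact: (fP h1 k).
Qed.

Section Equivariant.
Variables (H : groupType) (phi : {multiplicative H -> H}) (d : nat).
Hypothesis phi_order : forall h, iter d.+1 phi h = h.
Variables (Q : finGroupType) (f : {multiplicative H -> Q}).

Lemma iter_phiM n : {morph iter n phi : x y / x * y}.
Proof. by elim: n => // n IH x y; rewrite !iterS IH gmulfM. Qed.

Lemma orbit_act_inj h : injective (fun x : Q * 'I_d.+1 => (x.1 * f (iter x.2 phi h), x.2)).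
Proof. by move=> [x c] [x' c'] [+ cc]; rewrite cc => /mulIg ->. Qed.

(** Acting on the c-th copy of Q through h |-> f (phi^c h) turns phi into
    conjugation by the cyclic shift of the copies. *)
Definition orbit_act (h : H) : {perm Q * 'I_d.+1} := perm (@orbit_act_inj h).

Lemma orbit_actM : {morph orbit_act : x y / x * y}.
Proof. by move=> x y; apply/permP => z; rewrite permM !permE /= iter_phiM gmulfM mulgA. Qed.

HB.instance Definition _ := isMultiplicative.Build _ _ orbit_act orbit_actM.

Lemma orbit_shift_inj : injective (fun x : Q * 'I_d.+1 => (x.1, ordS x.2)).
Proof. move=> [x c] [x' c'] E; have /= -> := congr1 fst E.
have Ec : ordS c = ordS c' by exact: (congr1 snd E).
by rewrite (can_inj (@ordSK d.+1) Ec). Qed.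

Definition orbit_shift : {perm Q * 'I_d.+1} := perm orbit_shift_inj.

Lemma orbit_shiftP h : orbit_shift * orbit_act h * orbit_shift^-1 = orbit_act (phi h).
Proof.
apply: (mulIg orbit_shift); rewrite mulgVK; apply/permP => -[x c].
rewrite !permM !permE /=; congr (_ * f _, _).
rewrite -iterSr; have [E|ne] := eqVneq c.+1 d.+1; first by rewrite E modnn phi_order.
by rewrite modn_small //; have := ltn_ord c; rewrite ltnS leq_eqVlt -eqSS (negPf ne).
Qed.

Lemma equivariant_quotient : exists (Q' : finGroupType) (F : {multiplicative H -> Q'}) (s : Q'),
  (forall h, s * F h * s^-1 = F (phi h)) /\ forall h h', F h = F h' -> f h = f h'.
Proof.
exists {perm Q * 'I_d.+1}, orbit_act, orbit_shift; split; first exact: orbit_shiftP.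
move=> h h' /permP/(_ (1, ord0)); rewrite !permE /= !mul1g.
by case.
Qed.

End Equivariant.

Section HNNResiduallyFinite.
Variables (H : groupType) (K : set (H : Type)) (phi : {multiplicative H -> H}) (d : nat).
Hypothesis phi_order : forall h, iter d.+1 phi h = h.
Hypothesis K_group : group_closed (mem K).
Hypothesis sepK : separable K.
Local Notation G := (hnn K phi).
Local Notation base := (@hnn_base H K phi).
Local Notation word := (@hnn_word H K phi).
Local Notation t := (hnn_t K phi).

Lemma K_div x y : K x -> K y -> K (x / y).
Proof.
case: K_group => _ KF Kx Ky.
by have := KF x y; rewrite !inE; apply.
Qed.

Lemma K_one : K 1.
Proof. by case: K_group => + _; rewrite inE. Qed.

Lemma K_inv x : K x -> K x^-1.
Proof. by move=> /(K_div K_one); rewrite div1g. Qed.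

Lemma K_mul x y : K x -> K y -> K (x * y).
Proof. by move=> Kx /K_inv/(K_div Kx); rewrite invgK. Qed.

(** With x = (e, h), the case where t^e h t^-e belongs to H. *)
Definition pinch (x : bool * H) : Prop :=
  if x.1 then K x.2 else exists2 k, K k & x.2 = phi k.

Definition reduced (w : seq (bool * H)) : Prop :=
  forall w1 x y w2, w = w1 ++ x :: y :: w2 -> y.1 = ~~ x.1 -> ~ pinch x.

(** Replacing t^e h t^-e by an element of H removes two letters. *)
Lemma unreduced_shorter h w : ~ reduced w ->
  exists h' w', size w' < size w /\ word h w = word h' w'.
Proof.
move=> /existsNP[w1 /existsNP[[e x] /existsNP[[e' y] /existsNP[w2]]]].
move=> /not_implyP[-> /not_implyP[/= e'E /contrapT px]]; subst e'.
have [z zE] : exists z, stable_pow K phi e * base x * stable_pow K phi (~~ e) = base z.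
  rewrite /pinch /= in px; case: e px => /= px.
    by exists (phi x); rewrite hnn_conj.
  by case: px => k Kk ->; exists k; rewrite -hnn_conj // !mulgA mulVg mul1g mulgVK.
have wE : word h (w1 ++ (e, x) :: (~~ e, y) :: w2) =
    word h w1 * base (z * y) * \prod_(u <- w2) (stable_pow K phi u.1 * base u.2).
  by rewrite hnn_word_cat !big_cons /= hnn_baseM -zE !mulgA.
rewrite wE; case: (lastP w1) => [|w0 [e0 x0]].
  exists (h * (z * y)), w2; split; first by rewrite /=; lia.
  by rewrite /hnn_word big_nil mulg1 -hnn_baseM.
exists h, (rcons w0 (e0, x0 * (z * y)) ++ w2); split.
  by rewrite !size_cat !size_rcons /=; lia.
rewrite hnn_word_cat; congr (_ * _).
by rewrite -!cats1 !hnn_word_cat !big_seq1 /= (hnn_baseM _ _ x0) !mulgA.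
Qed.

Section Reduced.
Variables (Q : finGroupType) (F : {multiplicative H -> Q}) (s : Q).
Hypothesis sF : forall h, s * F h * s^-1 = F (phi h).
Variables (h0 : H) (w : seq (bool * H)).
Hypothesis w_red : reduced w.
Hypothesis F_sep : forall x k, x \in w -> ~ pinch x -> K k ->
  F x.2 <> F (if x.1 then k else phi k).
Local Notation n := (size w).
Local Notation x0 := (true, 1 : H).

Let F1 : F 1 = 1. Proof. exact: morph_one. Qed.

Definition pos (j : nat) : Q :=
  F h0 * \prod_(x <- take j w) ((if x.1 then s else s^-1) * F x.2).

Lemma posS j : j < n -> pos j.+1 =
  pos j * (if (nth x0 w j).1 then s else s^-1) * F (nth x0 w j).2.
Proof. by move=> jn; rewrite /pos (take_nth x0 jn) -cats1 big_cat big_seq1 !mulgA. Qed.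

(** For t^-1, the level permutation involved is the one of the coset reached. *)
Definition gate (j : nat) : Q := if (nth x0 w j).1 then pos j else pos j * s^-1.

Definition in_coset (x y : Q) : Prop := exists2 k, K k & y = x * F (phi k).

(** What the stable letter must do to the levels on the coset of x in order that
    reading w climbs from level j to level j.+1 at the j-th letter. *)
Definition jump (x : Q) (a b : 'I_n.+1) : Prop :=
  exists j, [/\ j < n, in_coset x (gate j) &
    if (nth x0 w j).1 then val a = j /\ val b = j.+1 else val a = j.+1 /\ val b = j].

Lemma in_coset_div x y z : in_coset x y -> in_coset x (y * F z) ->
  exists2 k, K k & F z = F (phi k).
Proof.
move=> [k Kk ->] [k' Kk' E]; exists (k^-1 * k'); first exact: K_mul (K_inv Kk) Kk'.
by apply: (mulgI (x * F (phi k))); rewrite E !gmulfM morph_inv morph_inv mulgA mulgK.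
Qed.

(** If two consecutive letters of opposite signs used one coset, the element of H
    between them would be in the image of K, or of phi K: F was chosen to
    avoid this, as the word has no pinch. *)
Lemma gate_neq x j : j.+1 < n -> (nth x0 w j.+1).1 = ~~ (nth x0 w j).1 ->
  in_coset x (gate j) -> in_coset x (gate j.+1) -> False.
Proof.
move=> jn sgn; have jn' := ltnW jn.
have wj : nth x0 w j \in w by rewrite mem_nth.
have npinch : ~ pinch (nth x0 w j).
  apply: (w_red (w1 := take j w) (w2 := drop j.+2 w) (y := nth x0 w j.+1)) => //.
  by rewrite -!drop_nth // cat_take_drop.
have sep := F_sep wj npinch.
rewrite /gate posS // sgn; case: (nth x0 w j).1 sep => /= sep.
  have -> : pos j * s * F (nth x0 w j).2 * s^-1 = pos j * F (phi (nth x0 w j).2).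
    by rewrite -sF !mulgA.
  move=> c1 c2; have [k Kk] := in_coset_div c1 c2; rewrite -!sF => /mulIg/mulgI.
  exact: sep.
by move=> c1 c2; have [k Kk] := in_coset_div c1 c2; exact: sep.
Qed.

Lemma jump_fun x a b b' : jump x a b -> jump x a b' -> b = b'.
Proof.
move=> [j [jn cj jP]] [j' [jn' cj' jP']]; apply/val_inj.
wlog lejj' : j j' b b' jn jn' cj cj' jP jP' / j <= j'.
  move=> W; have [le|/ltnW le] := leqP j j'; first exact: (W j j').
  by apply/esym/(W j' j).
have [E|ne] := eqVneq j j'.
  by move: jP jP'; rewrite -E; case: ifP => _ [_ ->] [_ ->].
have lt : j < j' by rewrite ltn_neqAle ne.
have j1 : j' = j.+1 /\ (nth x0 w j').1 = ~~ (nth x0 w j).1.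
  by move: jP jP'; case: ifP => _ [aE _]; case: ifP => _ [aE' _]; lia.
case: j1 => E sgn; subst j'.
by case: (gate_neq jn' sgn cj cj').
Qed.

Lemma jump_inj x a a' b : jump x a b -> jump x a' b -> a = a'.
Proof.
move=> [j [jn cj jP]] [j' [jn' cj' jP']]; apply/val_inj.
wlog lejj' : j j' a a' jn jn' cj cj' jP jP' / j <= j'.
  move=> W; have [le|/ltnW le] := leqP j j'; first exact: (W j j').
  by apply/esym/(W j' j).
have [E|ne] := eqVneq j j'.
  by move: jP jP'; rewrite -E; case: ifP => _ [-> _] [-> _].
have lt : j < j' by rewrite ltn_neqAle ne.
have j1 : j' = j.+1 /\ (nth x0 w j').1 = ~~ (nth x0 w j).1.
  by move: jP jP'; case: ifP => _ [_ bE]; case: ifP => _ [_ bE']; lia.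
case: j1 => E sgn; subst j'.
by case: (gate_neq jn' sgn cj cj').
Qed.

Lemma in_coset_shift x k : K k -> in_coset (x * F (phi k)) = in_coset x.
Proof.
move=> Kk; apply/funext => y; apply/propext; split=> -[k' Kk' ->].
  by exists (k * k'); rewrite ?gmulfM ?mulgA //; exact: K_mul.
exists (k^-1 * k'); first exact: K_mul (K_inv Kk) Kk'.
by rewrite !gmulfM !morph_inv mulgA mulgK.
Qed.

(** H acts on the pairs (x, level) by right multiplication on x. The stable letter
    multiplies x by s and permutes the levels in a way that depends on the coset
    of F (phi K) containing x only, so that the relations hold. The jumps are
    partial injections, hence such permutations exist that make w move
    (1, 0) to level n. *)
Lemma reduced_separated : 0 < n ->
  exists (P : finGroupType) (g : {multiplicative G -> P}), g (word h0 w) <> 1.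
Proof.
move=> n0.
have [lam lamP] : exists lam : (Q -> Prop) -> {perm 'I_n.+1},
    forall x a b, jump x a b -> lam (in_coset x) a = b.
  have : forall C : Q -> Prop, exists p : {perm 'I_n.+1},
      forall x a b, in_coset x = C -> jump x a b -> p a = b.
    move=> C; have [[x xC]|none] := pselect (exists x, in_coset x = C); last first.
      by exists 1 => x a b xC; case: none; exists x.
    have [p pP] := perm_of_partial (@jump_fun x) (@jump_inj x).
    exists p => y a b yC [j [jn cj jP]]; apply: pP; exists j; split=> //.
    by rewrite xC -yC.
  by move=> /choice[lam lamP]; exists lam => x a b; exact: lamP.
have base_inj h : injective (fun z : Q * 'I_n.+1 => (z.1 * F h, z.2)).
  by move=> [x a] [y b] [/mulIg-> ->].
have t_inj : injective (fun z : Q * 'I_n.+1 => (z.1 * s, lam (in_coset z.1) z.2)).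
  by move=> [x a] [y b] /= [/mulIg-> /perm_inj->].
pose B h : {perm Q * 'I_n.+1} := perm (base_inj h).
have BM : {morph B : x y / x * y}.
  by move=> x y; apply/permP => z; rewrite permM !permE /= gmulfM mulgA.
pose Bm : {multiplicative H -> {perm Q * 'I_n.+1}} :=
  HB.pack B (isMultiplicative.Build _ _ B BM).
pose T : {perm Q * 'I_n.+1} := perm t_inj.
have TB k : K k -> T * Bm k * T^-1 = Bm (phi k).
  move=> Kk; apply: (mulIg T); rewrite mulgVK; apply/permP => -[x a].
  rewrite !permM !permE /= in_coset_shift // -sF.
  by rewrite !mulgA mulgVK.
have [g [gB gt]] := hnn_lift TB.
exists {perm Q * 'I_n.+1}, g => /permP/(_ (1, ord0)); rewrite perm1.
suff track j : j <= n -> g (word h0 (take j w)) (1, ord0) = (pos j, inord j).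
  have := track n (leqnn n); rewrite take_size => -> [_] /(congr1 val).
  by rewrite /= inordK // => E; rewrite E in n0.
elim: j => [_|j IH jn].
  rewrite take0 /hnn_word /pos big_nil take0 big_nil !mulg1 gB permE /= mul1g.
  by congr pair; apply/val_inj; rewrite /= inordK.
rewrite (take_nth x0 jn) -cats1 hnn_word_cat big_seq1 gmulfM permM IH; last exact: ltnW.
rewrite posS //; have jin : val (inord j : 'I_n.+1) = j by rewrite /= inordK // ltnW.
have j1in : val (inord j.+1 : 'I_n.+1) = j.+1 by rewrite /= inordK.
have gateC : in_coset (gate j) (gate j).
  by exists 1; [exact: K_one|rewrite !morph_one mulg1].
have jmp : if (nth x0 w j).1 then jump (gate j) (inord j) (inord j.+1)
           else jump (gate j) (inord j.+1) (inord j).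
  by case E: (nth x0 w j).1; exists j; rewrite E jin j1in.
rewrite gmulfM permM gB /stable_pow; move: jmp; rewrite /gate.
case: (nth x0 w j).1 => /lamP lamj.
  by rewrite gt permE /= permE /= lamj.
have -> : g t^-1 (pos j, inord j) = (pos j * s^-1, inord j.+1).
  rewrite morph_inv gt; apply: (@perm_inj _ T); rewrite permKV permE /= lamj.
  by rewrite mulgVK.
by rewrite permE.
Qed.

End Reduced.

(** Pinches are removed until the word is reduced. If no stable letter is left, the
    element comes from H, and phi-equivariant quotients of H extend to G. *)
Theorem hnn_residually_finite : residually_finite H -> residually_finite G.
Proof.
move=> rfH g; have [h [w ->]] := hnn_wordP g.
have [m] := ubnP (size w); elim: m h w => // m IH h w lem.
have [red|nred] := pselect (reduced w); last first.
  have [h' [w' [lt ->]]] := unreduced_shorter h nred.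
  by apply: IH; apply: leq_trans lt _.
have [n0|] := posnP (size w).
  rewrite (size0nil n0) /hnn_word big_nil mulg1 => bh1.
  have h1 : h <> 1 by move=> E; apply: bh1; rewrite E; exact: morph_one.
  have [Q [f fh]] := rfH h h1.
  have [Q' [F [s [sF Ff]]]] := equivariant_quotient phi_order f.
  have [G' [G'b G't]] := hnn_lift (fun k (_ : K k) => sF k).
  exists Q', G'; rewrite G'b => Fh1; apply: fh.
  by rewrite -(morph_one f); apply: Ff; rewrite Fh1 morph_one.
move=> n0 _.
have phiK h1 : phi (iter d phi h1) = h1 by rewrite -iterS phi_order.
pose crit (x : bool * H) : H := if x.1 then x.2 else iter d phi x.2.
pose bad := [seq crit x | x <- w & `[< ~ pinch x >]].
have [|Q [f fP]] := separable_list (hs := bad) sepK.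
  move=> z /mapP[[e x]]; rewrite mem_filter => /andP[/asboolP np _] zE.
  rewrite {z}zE /crit; rewrite /pinch in np; case: e np => //= np Kx; apply: np.
  by exists (iter d phi x); rewrite ?phiK.
have [Q' [F [s [sF Ff]]]] := equivariant_quotient phi_order f.
apply: (@reduced_separated Q' F s sF h w red _ n0) => -[e x] k xw np Kk E.
have badx : crit (e, x) \in bad by apply: map_f; rewrite mem_filter xw andbT; apply/asboolP.
apply: (fP _ _ badx Kk); apply: Ff; move: E; rewrite /crit /=; case: (e) => // E.
apply: (mulgI s); apply: (mulIg s^-1).
by rewrite !sF phiK.
Qed.

End HNNResiduallyFinite.

(** * The groups T_P *)

Lemma finite_all (X : Type) : finite_set [set: X] ->
  exists s : seq {classic X}, forall x : {classic X}, x \in s.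
Proof.
move=> fX; have /finite_seqP[s sE] : finite_set [set: {classic X}] by [].
exists s => x; have : [set: {classic X}] x by [].
by rewrite sE.
Qed.

Section HatPresentation.
Variable P : presentation.
Local Notation X := (letters P).

Definition hat_embed : {multiplicative free_group X -> free_group (X + bool)} :=
  free_lift (fun x => gen (inl x)).

Definition hat_forget : {multiplicative free_group (X + bool) -> free_group X} :=
  free_lift (fun x : X + bool => if x is inl y then gen y else 1).

Definition hat_quotient : {multiplicative free_group (X + bool) -> pi1 P} :=
  ncl_proj (relators P) \o hat_forget.

Lemma free_morph_eq (Y : Type) (G' : groupType) (f g : {multiplicative free_group Y -> G'}) :
  (forall y, f (gen y) = g (gen y)) -> forall w, f w = g w.
Proof.
move=> fg; elim/free_word_ind=> [|w y e IH]; first by rewrite !morph_one.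
by rewrite !gmulfM IH; case: e; rewrite ?morph_inv fg.
Qed.

(** F(x-hat) modulo r-hat is pi1 P, because the two extra letters are killed. *)
Lemma hat_quotient_ker w :
  hat_quotient w = 1 <-> normal_closure (hat_relators P) w.
Proof.
pose q : {multiplicative _ -> _} := ncl_proj (hat_relators P).
have qE u : q (hat_embed (hat_forget u)) = q u.
  apply: (free_morph_eq (f := q \o hat_embed \o hat_forget)) => -[x|c] /=.
    by rewrite !free_lift_gen.
  rewrite !free_lift_gen morph_one morph_one; apply/esym/ncl_projP.
  rewrite invg1 mulg1; apply: normal_closure_sub; right.
  by case: c; [left|right].
split=> [/ncl_projP|].
  rewrite invg1 mulg1 => Nw.
  have : q (hat_embed (hat_forget w)) = 1.
    apply: (normal_closure_ker (f := q \o hat_embed) _ Nw) => r Rr /=.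
    apply/ncl_projP; rewrite invg1 mulg1; apply: normal_closure_sub; left.
    by exists r.
  by rewrite qE => /ncl_projP; rewrite invg1 mulg1.
apply: normal_closure_ker => r [[r' Rr' <-]|[]->] /=.
- have -> : hat_forget (free_lift (fun x => gen (inl x)) r') = r'.
    by apply: (free_morph_eq (f := hat_forget \o hat_embed) (g := idfun)) => x /=; rewrite !free_lift_gen.
  by apply/ncl_projP; rewrite invg1 mulg1; exact: normal_closure_sub.
- by rewrite /hat_forget /= free_lift_gen.
- by rewrite /hat_forget /= free_lift_gen.
Qed.

End HatPresentation.

Section Main.
Variables (i : nat) (i_ge6 : 6 <= i).
Local Notation H := (triangle_group i).

Lemma triangle_residually_finite : residually_finite H.
Proof.
move=> h h1.
(* the trivial subgroup, as the image of the free group on no letter *)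
pose one (A B : groupType) : {multiplicative A -> B} := @trivial_morphism A B.
have [[]|w _|Q [rho rhoP]] := @triangle_separable i i_ge6 False [::]
  (one _ _) ({perm 'I_0} : finGroupType) (one _ _) h => //.
exists Q, rho => rho1; apply: (rhoP 1); rewrite ?morph_one //.
Qed.

(** On generators: a |-> b |-> (a b)^-1 |-> a. *)
Lemma aut_order (D : TP_data i) h : iter 3 (aut D) h = h.
Proof.
have iM n : {morph iter n (aut D) : x y / x * y}.
  by elim: n => // n IH x y; rewrite !iterS IH gmulfM.
have [u ->] := triangle_word (leq_trans (isT : 0 < 6) i_ge6) h.
elim: u => [|l u IH]; first by rewrite big_nil /= !morph_one.
rewrite big_cons iM IH; congr (_ * _).
case: l; rewrite /= /tri_gen ?aut_a ?aut_b ?gmulfM ?morph_inv ?aut_a ?aut_b ?gmulfM ?morph_inv ?aut_a ?aut_b.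
  by rewrite invgM !invgK mulgK.
by rewrite invgM !invgK mulgK ?aut_a.
Qed.

Lemma K_P_group (D : TP_data i) (P : presentation) : group_closed (mem (K_P D P)).
Proof.
have [[N1 NF] _] := normal_closureP (hat_relators P).
split; first by rewrite inE; exists 1; [move: N1; rewrite inE|rewrite morph_one].
move=> _ _ /set_mem[x Nx <-] /set_mem[y Ny <-]; rewrite inE; exists (x / y).
  by have := NF x y; rewrite !inE; apply.
by rewrite gmulfM morph_inv.
Qed.

(** If h is not in M, it is enough to avoid M. Otherwise h is the image of a word w
    that is not trivial in pi1 P, and a finite quotient of pi1 P that detects w provides
    a subgroup of finite index in M that contains K but not h. *)
Lemma K_P_separable (D : TP_data i) (P : presentation) :
  finite_set [set: letters P] -> residually_finite (pi1 P) -> separable (K_P D P).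
Proof.
move=> finX rfP h Kh; have [s sX] := finite_all finX.
pose s' : seq {classic (letters P + bool)} :=
  [seq inl x : {classic (letters P + bool)} | x <- s] ++ [:: inr true; inr false].
have s'all (y : {classic (letters P + bool)}) : y \in s'.
  case: y => [x|c]; rewrite mem_cat.
    apply/orP; left.
    by apply/(@mapP {classic (letters P)} {classic (letters P + bool)}); exists x; rewrite ?sX.
  by apply/orP; right; rewrite !inE; case: c; rewrite eqxx ?orbT.
have [n cardn] : exists n, has_card (letters P + bool) n.
  have : finite_set [set: {classic (letters P + bool)}].
    by apply/finite_seqP; exists s'; apply/seteqP; split=> y //= _; exact: s'all.
  by move=> [n cn]; exists (Some n).
have ident_i := ident_inj cardn.
have [Q [psi [kerN hker]]] : exists (Q : finGroupType)
    (psi : {multiplicative free_group (letters P + bool) -> Q}),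
    (forall w, normal_closure (hat_relators P) w -> psi w = 1) /\
    forall w, psi w = 1 -> h <> ident D (letters P) w.
  have [[w hw]|hN] := pselect (exists w, h = ident D (letters P) w); last first.
    exists {perm 'I_0}; exists (@trivial_morphism _ ({perm 'I_0} : groupType)).
    by split=> // w _ hw; apply: hN; exists w.
  have w1 : hat_quotient P w <> 1.
    by move=> /hat_quotient_ker Nw; apply: Kh; exists w.
  have [Q [f fw]] := rfP _ w1.
  exists Q, (f \o hat_quotient P); split=> [u /hat_quotient_ker|u] /=.
    by move=> ->; rewrite morph_one.
  by move=> fu; rewrite hw => /ident_i wu; apply: fw; rewrite wu.
have [R [rho rhoP]] := triangle_separable i_ge6 s'all hker.
by exists R, rho => _ [w Nw <-]; apply: rhoP; exact: kerN.
Qed.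

End Main.

Theorem corollary4 (i : nat) (hi : 6 <= i) (D : TP_data i) (P : presentation) :
  finite_set [set: letters P]%classic ->
  residually_finite (pi1 P) ->
  residually_finite (T_P D P).
Proof.
move=> finX rfP; apply: (hnn_residually_finite (d := 2)).
- exact: aut_order.
- exact: K_P_group.
- exact: K_P_separable.
- exact: triangle_residually_finite.
Qed.
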